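(* Let $X$ be a variety over a trivially valued field $k$ and let $G$ be a finite group acting on $X$ whose order $|G|$ is relatively prime to the characteristic of $k$. Let $x\in X^*$ be a $G$-invariant valuation, and let $p\in X$ be the center of $x$. Let $U\subset X$ be an affine open subset that is stable under $G$ and contains $p$ (as a fixed point of $G$), let $\phi:U\to U/G$ be the geometric quotient, and set $y=\phi^{\mathrm{an}}(x)\in(U/G)^{\mathrm{an}}$. Then $$\widetilde{\mathscr{H}(x)}^{G}\cong\widetilde{\mathscr{H}(y)}.$$
   Context: A variety over $k$ is a separated integral scheme of finite type over $k$; $K(X)$ is its function field; $k$ carries the trivial norm. $G$ acts on $X$ means that a group homomorphism $G\to\mathrm{Aut}(X)$ (automorphisms over $k$) is fixed. If $U=\mathrm{Spec}\,A$, then $U/G=\mathrm{Spec}\,A^G$, with $\phi$ induced by $A^G\hookrightarrow A$. $X^{\mathrm{val}}$ is the set of points of the Berkovich analytification $X^{\mathrm{an}}$ lying over the generic point of $X$, i.e. multiplicative non-Archimedean real-valued norms $|\cdot|_x$ on $K(X)$ trivial on $k$. $x\in X^{\mathrm{val}}$ is $G$-invariant if $|f|_x=|\sigma^\sharp(f)|_x$ for all $f\in K(X)$, $\sigma\in G$, where $\sigma^\sharp:K(X)\to K(X)$ is induced by $\sigma:X\to X$. $\phi^{\mathrm{an}}$ is the induced map of analytifications (here $y$ is the restriction of $|\cdot|_x$ to $A^G$). $\mathscr{H}(x)$ is the completed residue field (equivalently, the completion of $K(X)$ with respect to $|\cdot|_x$), and $\widetilde{\mathscr{H}(x)}=\mathscr{H}(x)^\circ/\mathscr{H}(x)^{\circ\circ}$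 with $\mathscr{H}(x)^\circ=\{|f|_x\le1\}$, $\mathscr{H}(x)^{\circ\circ}=\{|f|_x<1\}$; similarly for $y$. If $x$ is $G$-invariant, $G$ acts on $\mathscr{H}(x)$ by isometries extending the maps $\sigma^\sharp$, hence on $\widetilde{\mathscr{H}(x)}$. Center: if $\mathrm{Spec}\,\mathscr{H}(x)\to X$ extends to $\mathrm{Spec}\,\mathscr{H}(x)^\circ\to X$ over $k$, the image of the closed point is the center $c_X(x)$; it gives a canonical injection $\kappa(c_X(x))\hookrightarrow\widetilde{\mathscr{H}(x)}$. $X^*$: the set of $x\in X^{\mathrm{val}}$ for which there is $\mathcal{X}\in B(X,x)$ with $\widetilde{\mathscr{H}(x)}=\kappa(c_{\mathcal{X}}(x))$ (via the canonical injection). Here (for $k$ trivially valued) $B(X,x)$ consists of all $k$-varieties $\mathcal{X}$ (in a fixed Grothendieck universe containing $X$) equipped with a proper birational morphism $f_{\mathcal{X}}:\mathcal{X}\to X$ such that the center $c_{\mathcal{X}}(x)$ of $x$, viewed in $\mathcal{X}^{\mathrm{val}}$ via $K(X)\cong K(\mathcal{X})$, exists, and such that for some non-empty open $V\subset X$ one has $f_{\mathcal{X}}^{-1}(V)=V$ and $f_{\mathcal{X}}|_{f_{\mathcal{X}}^{-1}(V)}=\mathrm{id}_V$. In particular every $x\in X^*$ has a center in $X$. *)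

(* Defs.v *)
From HB Require Import structures.
From mathcomp Require Import all_boot all_order all_algebra fingroup.
From mathcomp Require Import boolp classical_sets functions reals topology.
From mathcomp Require Import normedtype sequences.
From mathcomp Require Import ring.
Import Order.TTheory GRing.Theory Num.Theory.
Import numFieldNormedType.Exports.

Set Implicit Arguments.
Unset Strict Implicit.
Unset Printing Implicit Defensive.

Local Open Scope classical_set_scope.
Local Open Scope ring_scope.

(* Rings are [comPzRingType]s: the zero ring is allowed, as the sections over
   the empty set form one. *)

Section MkRmorphism.
Variables (A B : pzRingType) (f : A -> B) (f1 : f 1 = 1)
  (fD : forall a b, f (a + b) = f a + f b)
  (fM : forall a b, f (a * b) = f a * f b).
Let fB : zmod_morphism f.
Proof.
have f0 : f 0 = 0 by apply: (addIr (f 0)); rewrite -fD !add0r.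
have fN a : f (- a) = - f a by apply: (addIr (f a)); rewrite -fD !addNr.
by move=> a b; rewrite fD fN.
Qed.
Let fMM : monoid_morphism f := (f1, fM).
Definition mk_rmorphism : {rmorphism A -> B} :=
  HB.pack f (GRing.isZmodMorphism.Build A B f fB)
    (GRing.isMonoidMorphism.Build A B f fMM).
Lemma mk_rmorphismE a : mk_rmorphism a = f a. Proof. by []. Qed.
End MkRmorphism.

(* A commutative ring presented by representatives: operations on a type which
   satisfy the ring axioms up to an equivalence relation. *)
Record preRing := PreRing {
  pcar :> Type;
  peq : pcar -> pcar -> Prop;
  pz : pcar; po : pcar; pn : pcar -> pcar;
  pa : pcar -> pcar -> pcar; pm : pcar -> pcar -> pcar;
  peq_refl : forall a, peq a a;
  peq_sym : forall a b, peq a b -> peq b a;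
  peq_trans : forall a b c, peq a b -> peq b c -> peq a c;
  pn_eq : forall a b, peq a b -> peq (pn a) (pn b);
  pa_eq : forall a b c d, peq a b -> peq c d -> peq (pa a c) (pa b d);
  pm_eq : forall a b c d, peq a b -> peq c d -> peq (pm a c) (pm b d);
  paA : forall a b c, peq (pa a (pa b c)) (pa (pa a b) c);
  paC : forall a b, peq (pa a b) (pa b a);
  pa0 : forall a, peq (pa pz a) a;
  paN : forall a, peq (pa (pn a) a) pz;
  pmA : forall a b c, peq (pm a (pm b c)) (pm (pm a b) c);
  pmC : forall a b, peq (pm a b) (pm b a);
  pm1 : forall a, peq (pm po a) a;
  pmD : forall a b c, peq (pm (pa a b) c) (pa (pm a c) (pm b c)) }.

Lemma sig_inj (T : Type) (P : T -> Prop) (a b : {x | P x}) :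
  sval a = sval b -> a = b.
Proof.
case: a b => [a ha] [b hb] /= e; move: ha hb; rewrite e => ha hb.
by rewrite (Prop_irrelevance ha hb).
Qed.

Definition quo (S : preRing) : Type := {C : set S | exists a, C = @peq S a}.

Section Quo.
Variable S : preRing.
HB.instance Definition _ := gen_eqMixin (quo S).
HB.instance Definition _ := gen_choiceMixin (quo S).

Definition cls (a : S) : quo S := exist _ (@peq S a) (ex_intro _ a erefl).
Definition rep (c : quo S) : S := projT1 (cid (projT2 c)).

Lemma clsP (a b : S) : cls a = cls b <-> peq a b.
Proof.
split=> [[e]|e]; first by rewrite e; apply: peq_refl.
have ee : @peq S a = @peq S b.
  apply/funext => c; apply/propext; split; apply: peq_trans => //.
  exact: peq_sym.
by apply: sig_inj.
Qed.

Lemma repK c : cls (rep c) = c.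
Proof. by apply: sig_inj; rewrite /rep; case: cid. Qed.

Lemma rep_cls a : peq (rep (cls a)) a.
Proof. by apply/clsP; rewrite repK. Qed.

Lemma quoP (P : quo S -> Prop) : (forall a, P (cls a)) -> forall c, P c.
Proof. by move=> h c; rewrite -(repK c). Qed.

Let qa (c d : quo S) := cls (pa (rep c) (rep d)).
Let qm (c d : quo S) := cls (pm (rep c) (rep d)).
Let qn (c : quo S) := cls (pn (rep c)).
Let qaE a b : qa (cls a) (cls b) = cls (pa a b).
Proof. by apply/clsP; apply: pa_eq; apply: rep_cls. Qed.
Let qmE a b : qm (cls a) (cls b) = cls (pm a b).
Proof. by apply/clsP; apply: pm_eq; apply: rep_cls. Qed.
Let qnE a : qn (cls a) = cls (pn a).
Proof. by apply/clsP; apply: pn_eq; apply: rep_cls. Qed.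

Let qaA : associative qa.
Proof. by do 3!elim/quoP => ?; rewrite !qaE; apply/clsP; apply: paA. Qed.
Let qaC : commutative qa.
Proof. by do 2!elim/quoP => ?; rewrite !qaE; apply/clsP; apply: paC. Qed.
Let qa0 : left_id (cls (pz S)) qa.
Proof. by elim/quoP => ?; rewrite !qaE; apply/clsP; apply: pa0. Qed.
Let qaN : left_inverse (cls (pz S)) qn qa.
Proof. by elim/quoP => ?; rewrite qnE qaE; apply/clsP; apply: paN. Qed.
HB.instance Definition _ := GRing.isZmodule.Build (quo S) qaA qaC qa0 qaN.
Let qmA : associative qm.
Proof. by do 3!elim/quoP => ?; rewrite !qmE; apply/clsP; apply: pmA. Qed.
Let qmC : commutative qm.
Proof. by do 2!elim/quoP => ?; rewrite !qmE; apply/clsP; apply: pmC. Qed.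
Let qm1 : left_id (cls (po S)) qm.
Proof. by elim/quoP => ?; rewrite !qmE; apply/clsP; apply: pm1. Qed.
Let qmD : left_distributive qm qa.
Proof.
by do 3!elim/quoP => ?; rewrite !(qmE, qaE); apply/clsP; apply: pmD.
Qed.
HB.instance Definition _ :=
  GRing.Zmodule_isComPzRing.Build (quo S) qmA qmC qm1 qmD.

Lemma clsD (a b : S) : cls (pa a b) = cls a + cls b.
Proof. by rewrite -qaE. Qed.
Lemma clsM (a b : S) : cls (pm a b) = cls a * cls b.
Proof. by rewrite -qmE. Qed.
Lemma clsN (a : S) : cls (pn a) = - cls a.
Proof. by rewrite -qnE. Qed.
Lemma cls0 : cls (pz S) = 0. Proof. by []. Qed.
Lemma cls1 : cls (po S) = 1. Proof. by []. Qed.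

Definition quo_lift (B : pzRingType) (f : S -> B)
    (fe : forall a b, peq a b -> f a = f b) (f1 : f (po S) = 1)
    (fD : forall a b, f (pa a b) = f a + f b)
    (fM : forall a b, f (pm a b) = f a * f b) : {rmorphism quo S -> B}.
Proof.
apply: (@mk_rmorphism _ _ (fun c => f (rep c))).
- by rewrite -f1; apply/fe/rep_cls.
- by do 2!elim/quoP => ?; rewrite -fD; apply/fe; rewrite -clsD;
    apply: peq_trans (rep_cls _) _; apply: pa_eq; apply/peq_sym/rep_cls.
- by do 2!elim/quoP => ?; rewrite -fM; apply/fe; rewrite -clsM;
    apply: peq_trans (rep_cls _) _; apply: pm_eq; apply/peq_sym/rep_cls.
Defined.

Lemma quo_liftE B f fe f1 fD fM a :
  @quo_lift B f fe f1 fD fM (cls a) = f a.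
Proof. by rewrite /quo_lift /=; apply/fe/rep_cls. Qed.
End Quo.

Record subring (A : comPzRingType) := Subring {
  sset :> A -> Prop;
  sset1 : sset 1;
  ssetB : forall a b, sset a -> sset b -> sset (a - b);
  ssetM : forall a b, sset a -> sset b -> sset (a * b) }.

Definition sub_ring (A : comPzRingType) (S : subring A) : Type :=
  {a : A | `[< S a >]}.

Section SubRing.
Variables (A : comPzRingType) (S : subring A).
HB.instance Definition _ := SubType.copy (sub_ring S) {a : A | `[< S a >]}.
HB.instance Definition _ := Choice.copy (sub_ring S) {a : A | `[< S a >]}.
Let sub_closed : subring_closed (fun a => `[< S a >]).
Proof.
split=> [|a b /asboolP ha /asboolP hb|a b /asboolP ha /asboolP hb]; apply/asboolP.
- exact: sset1.
- exact: ssetB.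
- exact: ssetM.
Qed.
HB.instance Definition _ :=
  GRing.SubChoice_isSubComPzRing.Build A (fun a => `[< S a >]) (sub_ring S)
    sub_closed.

Definition mksub (a : A) (ha : S a) : sub_ring S := exist _ a (asboolT ha).
Lemma val_mksub a ha : val (@mksub a ha) = a. Proof. by []. Qed.
Lemma subP (a : sub_ring S) : S (val a).
Proof. by case: a => a /= /asboolP. Qed.
Definition sub_val : {rmorphism sub_ring S -> A} := val.

Definition sub_lift (B : pzRingType) (f : {rmorphism B -> A})
    (hf : forall b, S (f b)) : {rmorphism B -> sub_ring S}.
Proof.
apply: (@mk_rmorphism _ _ (fun b => mksub (hf b))).
- by apply: val_inj; rewrite /= !rmorph1.
- by move=> a b; apply: val_inj; rewrite /= !rmorphD.
- by move=> a b; apply: val_inj; rewrite /= !rmorphM.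
Defined.
Lemma val_sub_lift B f hf b : val (@sub_lift B f hf b) = f b.
Proof. by []. Qed.
End SubRing.

Definition dprod (I : Type) (L : I -> comPzRingType) : Type := forall i, L i.

Section Dprod.
Variables (I : Type) (L : I -> comPzRingType).
HB.instance Definition _ := gen_eqMixin (dprod L).
HB.instance Definition _ := gen_choiceMixin (dprod L).
Let da (f g : dprod L) : dprod L := fun i => f i + g i.
Let dm (f g : dprod L) : dprod L := fun i => f i * g i.
Let dn (f : dprod L) : dprod L := fun i => - f i.
Let d0 : dprod L := fun=> 0.
Let d1 : dprod L := fun=> 1.
Let daA : associative da.
Proof. by move=> f g h; apply: functional_extensionality_dep => i; apply: addrA. Qed.
Let daC : commutative da.
Proof. by move=> f g; apply: functional_extensionality_dep => i; apply: addrC. Qed.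
Let da0 : left_id d0 da.
Proof. by move=> f; apply: functional_extensionality_dep => i; apply: add0r. Qed.
Let daN : left_inverse d0 dn da.
Proof. by move=> f; apply: functional_extensionality_dep => i; apply: addNr. Qed.
HB.instance Definition _ := GRing.isZmodule.Build (dprod L) daA daC da0 daN.
Let dmA : associative dm.
Proof. by move=> f g h; apply: functional_extensionality_dep => i; apply: mulrA. Qed.
Let dmC : commutative dm.
Proof. by move=> f g; apply: functional_extensionality_dep => i; apply: mulrC. Qed.
Let dm1 : left_id d1 dm.
Proof. by move=> f; apply: functional_extensionality_dep => i; apply: mul1r. Qed.
Let dmD : left_distributive dm da.
Proof. by move=> f g h; apply: functional_extensionality_dep => i; apply: mulrDl. Qed.
HB.instance Definition _ :=
  GRing.Zmodule_isComPzRing.Build (dprod L) dmA dmC dm1 dmD.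
End Dprod.

Definition is_unit (A : comPzRingType) (a : A) := exists b, a * b = 1.


Record spec (A : comPzRingType) := MkSpec {
  sideal :> A -> Prop;
  spec0 : sideal 0;
  specD : forall a b, sideal a -> sideal b -> sideal (a + b);
  specMl : forall a b, sideal b -> sideal (a * b);
  spec1 : ~ sideal 1;
  specM : forall a b, sideal (a * b) -> sideal a \/ sideal b }.

Lemma specNM (A : comPzRingType) (p : spec A) (a b : A) :
  ~ p a -> ~ p b -> ~ p (a * b).
Proof. by move=> ha hb /specM []. Qed.

(* The local ring of [A] at [p]; [(a, s)] stands for a / s. *)
Section Localization.
Variables (A : comPzRingType) (p : spec A).

Definition lcar : Type := A * {s : A | ~ p s}.
Definition leq_ (x y : lcar) := exists2 u, ~ p u &
  u * (x.1 * sval y.2) = u * (y.1 * sval x.2).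
Definition ls1 : {s : A | ~ p s} := exist _ 1 (@spec1 A p).
Definition lsM (s t : {s : A | ~ p s}) : {s : A | ~ p s} :=
  exist _ (sval s * sval t) (specNM (svalP s) (svalP t)).
Definition loc_pre : preRing.
Proof.
apply: (@PreRing lcar leq_ (0, ls1) (1, ls1) (fun x => (- x.1, x.2))
  (fun x y => (x.1 * sval y.2 + y.1 * sval x.2, lsM x.2 y.2))
  (fun x y => (x.1 * y.1, lsM x.2 y.2))).
- by move=> a; exists 1 => //; apply: spec1.
- by move=> a b [u hu e]; exists u.
- move=> [a [s hs]] [b [t ht]] [c [v hv]] [u hu /= e] [w hw /= f].
  exists (u * w * t) => /=; first by apply: specNM => //; apply: specNM.
  have -> : u * w * t * (a * v) = (u * (a * t)) * (w * v) by ring.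
  rewrite e; have -> : u * (b * s) * (w * v) = (w * (b * v)) * (u * s) by ring.
  by rewrite f; ring.
- move=> [a [s hs]] [b [t ht]] [u hu /= e]; exists u => //=.
  by rewrite !mulNr !mulrN e.
- move=> [a [s hs]] [b [t ht]] [c [v hv]] [d [z hz]] [u hu /= e] [w hw /= f].
  exists (u * w) => /=; first exact: specNM.
  transitivity ((u * (a * t)) * (w * v * z) + (w * (c * z)) * (u * s * t)).
    by ring.
  by rewrite e f; ring.
- move=> [a [s hs]] [b [t ht]] [c [v hv]] [d [z hz]] [u hu /= e] [w hw /= f].
  exists (u * w) => /=; first exact: specNM.
  transitivity ((u * (a * t)) * (w * (c * z))); first by ring.
  by rewrite e f; ring.
- by move=> [a s] [b t] [c v]; exists 1; [exact: spec1|rewrite /=; ring].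
- by move=> [a s] [b t]; exists 1; [exact: spec1|rewrite /=; ring].
- by move=> [a s]; exists 1; [exact: spec1|rewrite /=; ring].
- by move=> [a s]; exists 1; [exact: spec1|rewrite /=; ring].
- by move=> [a s] [b t] [c v]; exists 1; [exact: spec1|rewrite /=; ring].
- by move=> [a s] [b t]; exists 1; [exact: spec1|rewrite /=; ring].
- by move=> [a s]; exists 1; [exact: spec1|rewrite /=; ring].
- by move=> [a s] [b t] [c v]; exists 1; [exact: spec1|rewrite /=; ring].
Defined.

Definition loc : comPzRingType := quo loc_pre.

Definition frac (a s : A) (hs : ~ p s) : loc := @cls loc_pre (a, exist _ s hs).

Definition to_loc : {rmorphism A -> loc}.
Proof.
apply: (@mk_rmorphism _ _ (fun a => frac a (@spec1 A p))) => //.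
- by move=> a b; rewrite -clsD; apply/clsP; exists 1; [exact: spec1|rewrite /=; ring].
- by move=> a b; rewrite -clsM; apply/clsP; exists 1; [exact: spec1|rewrite /=; ring].
Defined.

Lemma fracP (x : loc) : exists a s (hs : ~ p s), x = frac a hs.
Proof. by move: x; apply: quoP => -[a [s hs]]; exists a, s, hs. Qed.

Lemma frac_eq a s (hs : ~ p s) b t (ht : ~ p t) :
  frac a hs = frac b ht <-> exists2 u, ~ p u & u * (a * t) = u * (b * s).
Proof. exact: clsP. Qed.

Lemma frac_mul a s (hs : ~ p s) : frac a hs * to_loc s = to_loc a.
Proof. by rewrite -clsM; apply/clsP; exists 1; [exact: spec1|rewrite /=; ring]. Qed.

Lemma to_loc_unit s : ~ p s -> is_unit (to_loc s).
Proof.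
move=> hs; exists (frac 1 hs); rewrite -clsM -cls1; apply/clsP.
by exists 1; [exact: spec1|rewrite /=; ring].
Qed.

Lemma unit_fracP a s (hs : ~ p s) : is_unit (frac a hs) <-> ~ p a.
Proof.
split=> [[x]|ha].
  have [b [t [ht ->]]] := fracP x; rewrite -clsM -cls1 => /clsP[u hu /= e].
  move=> ha; have : p (u * (s * t)).
    rewrite -[s * t]mul1r -e !mulr1 mulrC mulrAC.
    by rewrite mulrC; apply: specMl; rewrite mulrC; apply: specMl.
  by apply: specNM => //; apply: specNM.
exists (frac s ha); rewrite -clsM -cls1; apply/clsP.
by exists 1; [exact: spec1|rewrite /=; ring].
Qed.

Lemma loc1_neq0 : 1 <> 0 :> loc.
Proof. by move/clsP => -[u hu /=]; rewrite !mul0r mulr0 !mulr1 => u0; apply: hu; rewrite u0; apply: spec0. Qed.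

Lemma unit_mulI (x y z : loc) : is_unit z -> x * z = y * z -> x = y.
Proof. by move=> [w zw] /(congr1 ( *%R^~ w)); rewrite -!mulrA zw !mulr1. Qed.
End Localization.

Record opens (X : topologicalType) := Opens {
  oset :> set X;
  oopen : open oset }.

Definition opensT (X : topologicalType) : opens X := Opens openT.
Definition opensI (X : topologicalType) (U V : opens X) : opens X :=
  Opens (openI (oopen U) (oopen V)).
Lemma opensIl (X : topologicalType) (U V : opens X) : opensI U V `<=` U.
Proof. by move=> x []. Qed.
Lemma opensIr (X : topologicalType) (U V : opens X) : opensI U V `<=` V.
Proof. by move=> x []. Qed.
Lemma opens_refl (X : topologicalType) (U : opens X) : U `<=` U.
Proof. by []. Qed.
Arguments opens_refl {X U}.
Definition opens_pre (X Y : topologicalType) (f : X -> Y) (hf : continuous f)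
    (V : opens Y) : opens X :=
  Opens ((continuousP f).1 hf V (oopen V)).

(* The structure ring is only required to be a presheaf here; the sheaf condition
   and the locality of the stalks are part of [scheme]. *)
Record rspace := RSpace {
  rpt :> topologicalType;
  sec : opens rpt -> comPzRingType;
  res : forall U V : opens rpt, U `<=` V -> {rmorphism sec V -> sec U};
  res_id : forall (U : opens rpt) (h : U `<=` U) s, res h s = s;
  res_comp : forall (U V W : opens rpt) (h1 : U `<=` V) (h2 : V `<=` W)
    (h3 : U `<=` W) s, res h1 (res h2 s) = res h3 s }.
Arguments sec : clear implicits.

Definition is_sheaf (X : rspace) : Prop :=
  (forall (I : Type) (U : I -> opens X) (V : opens X) (hU : forall i, U i `<=` V),
    V `<=` \bigcup_i U i ->
    forall s t : sec X V, (forall i, res (hU i) s = res (hU i) t) -> s = t) /\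
  (forall (I : Type) (U : I -> opens X) (V : opens X) (hU : forall i, U i `<=` V),
    V `<=` \bigcup_i U i ->
    forall s : forall i, sec X (U i),
    (forall i j (W : opens X) (hi : W `<=` U i) (hj : W `<=` U j),
      res hi (s i) = res hj (s j)) ->
    exists t : sec X V, forall i, res (hU i) t = s i).

(* Families of open sets over which direct limits of sections are taken: the
   neighbourhoods of a point give the stalk, the nonempty open sets of an
   integral scheme give the function field. *)
Record direction (X : topologicalType) := Direction {
  dir :> opens X -> Prop;
  dirT : dir (opensT X);
  dirI : forall U V, dir U -> dir V -> dir (opensI U V) }.

Section Germs.
Variables (X : rspace) (B : direction X).

Record gcar := GCar { gU : opens X; gB : B gU; gs : sec X gU }.

Definition geq_ (a b : gcar) : Prop :=
  exists W (_ : B W) (h1 : W `<=` gU a) (h2 : W `<=` gU b),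
    res h1 (gs a) = res h2 (gs b).

Definition gop2 (op : forall U, sec X U -> sec X U -> sec X U) (a b : gcar) : gcar :=
  GCar (dirI (gB a) (gB b))
    (op _ (res (@opensIl _ (gU a) (gU b)) (gs a))
          (res (@opensIr _ (gU a) (gU b)) (gs b))).

Lemma geq2 op : (forall (U V : opens X) (h : U `<=` V) (s t : sec X V),
    res h (op V s t) = op U (res h s) (res h t)) ->
  forall a b c d, geq_ a b -> geq_ c d -> geq_ (gop2 op a c) (gop2 op b d).
Proof.
move=> hop a b c d [W [hW [h1 [h2 e]]]] [W' [hW' [h1' [h2' e']]]].
have k1 : W `&` W' `<=` gU a by move=> x [] /h1.
have k2 : W `&` W' `<=` gU b by move=> x [] /h2.
have k3 : W `&` W' `<=` gU c by move=> x [] _ /h1'.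
have k4 : W `&` W' `<=` gU d by move=> x [] _ /h2'.
exists (opensI W W'), (dirI hW hW').
have i1 : opensI W W' `<=` gU (gop2 op a c) by move=> x hx; split; auto.
have i2 : opensI W W' `<=` gU (gop2 op b d) by move=> x hx; split; auto.
exists i1, i2; rewrite /= !hop.
rewrite (res_comp _ _ (U := opensI W W') k1) (res_comp _ _ (U := opensI W W') k2).
rewrite (res_comp _ _ (U := opensI W W') k3) (res_comp _ _ (U := opensI W W') k4).
rewrite -(res_comp (@opensIl _ W W') h1) e.
rewrite -(res_comp (@opensIr _ W W') h1') e'.
by rewrite !(res_comp _ _ (U := opensI W W') k2) (res_comp _ _ (U := opensI W W') k4).
Qed.

Let add_ U (s t : sec X U) := s + t.
Let mul_ U (s t : sec X U) := s * t.
Let geqD : forall a b c d, geq_ a b -> geq_ c d ->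
  geq_ (gop2 add_ a c) (gop2 add_ b d).
Proof. by apply: geq2 => *; rewrite /add_ rmorphD. Qed.
Let geqM : forall a b c d, geq_ a b -> geq_ c d ->
  geq_ (gop2 mul_ a c) (gop2 mul_ b d).
Proof. by apply: geq2 => *; rewrite /mul_ rmorphM. Qed.

Definition germ_pre : preRing.
Proof.
apply: (@PreRing gcar geq_ (GCar (dirT B) 0) (GCar (dirT B) 1)
  (fun a => GCar (gB a) (- gs a)) (gop2 add_) (gop2 mul_) _ _ _ _ geqD geqM).
- by move=> a; exists (gU a), (gB a), opens_refl, opens_refl.
- by move=> a b [W [hW [h1 [h2 e]]]]; exists W, hW, h2, h1.
- move=> a b c [W [hW [h1 [h2 e]]]] [W' [hW' [h1' [h2' e']]]].
  have k1 : opensI W W' `<=` gU a by move=> x [] /h1.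
  have k2 : opensI W W' `<=` gU b by move=> x [] /h2.
  have k3 : opensI W W' `<=` gU c by move=> x [] _ /h2'.
  exists _, (dirI hW hW'), k1, k3.
  rewrite -(res_comp (@opensIl _ W W') h1) e.
  rewrite (res_comp _ _ k2).
  rewrite -(res_comp (@opensIr _ W W') h1') e'.
  by rewrite (res_comp _ _ k3).
- move=> a b [W [hW [h1 [h2 e]]]]; exists W, hW, h1, h2.
  by rewrite /= !rmorphN e.
- move=> a b c.
  have k1 : opensI (gU a) (opensI (gU b) (gU c)) `<=` gU a by move=> x [].
  have k2 : opensI (gU a) (opensI (gU b) (gU c)) `<=` gU b by move=> x [_ []].
  have k3 : opensI (gU a) (opensI (gU b) (gU c)) `<=` gU c by move=> x [_ []].
  have k4 : opensI (gU a) (opensI (gU b) (gU c)) `<=`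
    gU (gop2 add_ (gop2 add_ a b) c) by move=> x [? []].
  exists _, (dirI (gB a) (dirI (gB b) (gB c))), opens_refl, k4.
  have k5 : opensI (gU a) (opensI (gU b) (gU c)) `<=` opensI (gU a) (gU b).
    by move=> x [? []].
  rewrite /= /add_ !rmorphD !(res_comp _ _ k5) !(res_comp _ _ k1) !(res_comp _ _ k2) !(res_comp _ _ k3).
  by rewrite /= addrA.
- move=> a b.
  have k : opensI (gU a) (gU b) `<=` gU (gop2 add_ b a) by move=> x [].
  exists _, (dirI (gB a) (gB b)), opens_refl, k.
  rewrite /= /add_ !rmorphD !(res_comp _ _ (@opensIl _ (gU a) (gU b))).
  by rewrite !(res_comp _ _ (@opensIr _ (gU a) (gU b))) addrC.
- move=> a.
  have k : gU a `<=` gU (gop2 add_ (GCar (dirT B) 0) a) by move=> x.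
  exists _, (gB a), k, opens_refl.
  by rewrite /= /add_ !rmorphD !rmorph0 add0r !(res_comp _ _ opens_refl).
- move=> a.
  have k : gU a `<=` gU (gop2 add_ (GCar (gB a) (- gs a)) a) by move=> x.
  have kT : gU a `<=` opensT X by [].
  exists _, (gB a), k, kT.
  rewrite /= /add_ !rmorphD !rmorphN rmorph0 !(res_comp _ _ opens_refl).
  by rewrite addNr.
- move=> a b c.
  have k1 : opensI (gU a) (opensI (gU b) (gU c)) `<=` gU a by move=> x [].
  have k2 : opensI (gU a) (opensI (gU b) (gU c)) `<=` gU b by move=> x [_ []].
  have k3 : opensI (gU a) (opensI (gU b) (gU c)) `<=` gU c by move=> x [_ []].
  have k4 : opensI (gU a) (opensI (gU b) (gU c)) `<=`
    gU (gop2 mul_ (gop2 mul_ a b) c) by move=> x [? []].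
  exists _, (dirI (gB a) (dirI (gB b) (gB c))), opens_refl, k4.
  have k5 : opensI (gU a) (opensI (gU b) (gU c)) `<=` opensI (gU a) (gU b).
    by move=> x [? []].
  rewrite /= /mul_ !rmorphM !(res_comp _ _ k5) !(res_comp _ _ k1) !(res_comp _ _ k2) !(res_comp _ _ k3).
  by rewrite /= mulrA.
- move=> a b.
  have k : opensI (gU a) (gU b) `<=` gU (gop2 mul_ b a) by move=> x [].
  exists _, (dirI (gB a) (gB b)), opens_refl, k.
  rewrite /= /mul_ !rmorphM !(res_comp _ _ (@opensIl _ (gU a) (gU b))).
  by rewrite !(res_comp _ _ (@opensIr _ (gU a) (gU b))) mulrC.
- move=> a.
  have k : gU a `<=` gU (gop2 mul_ (GCar (dirT B) 1) a) by move=> x.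
  exists _, (gB a), k, opens_refl.
  by rewrite /= /mul_ !rmorphM !rmorph1 mul1r !(res_comp _ _ opens_refl).
- move=> a b c.
  set U := opensI (opensI (gU a) (gU b)) (gU c).
  have k1 : U `<=` gU a by move=> x [[]].
  have k2 : U `<=` gU b by move=> x [[]].
  have k3 : U `<=` gU c by move=> x [[]].
  have k4 : U `<=` gU (gop2 add_ (gop2 mul_ a c) (gop2 mul_ b c)).
    by move=> x [[? ?] ?].
  exists _, (dirI (dirI (gB a) (gB b)) (gB c)), opens_refl, k4.
  have k5 : U `<=` opensI (gU a) (gU b) by move=> x [].
  have k6 : U `<=` opensI (gU a) (gU c) by move=> x [[? ?] ?].
  have k7 : U `<=` opensI (gU b) (gU c) by move=> x [[? ?] ?].
  rewrite /= /mul_ /add_ !(rmorphD, rmorphM) !(res_comp _ _ k5) !(res_comp _ _ k6) !(res_comp _ _ k7).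
  by rewrite !(res_comp _ _ k1) !(res_comp _ _ k2) !(res_comp _ _ k3) mulrDl.
Defined.

Definition germs : comPzRingType := quo germ_pre.

Definition germ (U : opens X) (hU : B U) (s : sec X U) : germs :=
  @cls germ_pre (GCar hU s).

Lemma germP (U V : opens X) (hU : B U) (hV : B V) s t :
  germ hU s = germ hV t <->
  exists W (_ : B W) (h1 : W `<=` U) (h2 : W `<=` V), res h1 s = res h2 t.
Proof. exact: clsP. Qed.

Lemma germE (x : germs) : exists U (hU : B U) s, x = germ hU s.
Proof. by move: x; apply: quoP => -[U hU s]; exists U, hU, s. Qed.

Lemma germ_res (U V : opens X) (hU : B U) (hV : B V) (h : U `<=` V) s :
  germ hU (res h s) = germ hV s.
Proof. by apply/germP; exists U, hU, opens_refl, h; apply: res_id. Qed.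

Lemma germ_op (op : forall U, sec X U -> sec X U -> sec X U) (U : opens X)
    (hU : B U) (s t : sec X U) :
  (forall (U V : opens X) (h : U `<=` V) (s t : sec X V),
    res h (op V s t) = op U (res h s) (res h t)) ->
  germ hU (op U s t) = @cls germ_pre (gop2 op (GCar hU s) (GCar hU t)).
Proof.
move=> hop; apply/clsP.
have k : U `<=` gU (gop2 op (GCar hU s) (GCar hU t)) by move=> x.
exists U, hU, opens_refl, k.
by rewrite /= !hop !(res_comp _ _ opens_refl).
Qed.

Definition to_germs (U : opens X) (hU : B U) : {rmorphism sec X U -> germs}.
Proof.
apply: (@mk_rmorphism _ _ (germ hU)).
- apply/clsP; have k : U `<=` opensT X by [].
  by exists U, hU, opens_refl, k; rewrite /= !rmorph1.
- by move=> s t; rewrite -clsD -(germ_op (op := add_)) // => *; rewrite /add_ rmorphD.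
- by move=> s t; rewrite -clsM -(germ_op (op := mul_)) // => *; rewrite /mul_ rmorphM.
Defined.

Lemma to_germsE U hU s : @to_germs U hU s = germ hU s. Proof. by []. Qed.

Lemma germD (U : opens X) (hU : B U) s t : germ hU (s + t) = germ hU s + germ hU t.
Proof. exact: (rmorphD (to_germs hU)). Qed.
Lemma germM (U : opens X) (hU : B U) s t : germ hU (s * t) = germ hU s * germ hU t.
Proof. exact: (rmorphM (to_germs hU)). Qed.
Lemma germ1 (U : opens X) (hU : B U) : germ hU 1 = 1.
Proof. exact: (rmorph1 (to_germs hU)). Qed.
Lemma germ0 (U : opens X) (hU : B U) : germ hU 0 = 0.
Proof. exact: (rmorph0 (to_germs hU)). Qed.
End Germs.

Definition dnbhs (X : topologicalType) (p : X) : direction X.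
Proof. by apply: (@Direction X (fun U => oset U p)). Defined.

Definition stalk (X : rspace) (p : X) : comPzRingType := germs (dnbhs p).

(* Morphisms of ringed spaces. [sharp h : O_Y(V) -> O_X(U)] is given for all U
   contained in the inverse image of V; it is the usual map O_Y(V) ->
   O_X(f^-1 V) followed by the restriction to U. *)
Record rmor (X Y : rspace) := RMor {
  rfun :> X -> Y;
  rcont : continuous rfun;
  sharp : forall (V : opens Y) (U : opens X), U `<=` rfun @^-1` V ->
    {rmorphism sec Y V -> sec X U};
  sharp_res : forall (V V' : opens Y) (U U' : opens X) (hV : V' `<=` V)
    (hU : U' `<=` U) (h : U `<=` rfun @^-1` V) (h' : U' `<=` rfun @^-1` V') s,
    res hU (sharp h s) = sharp h' (res hV s) }.

Definition rpre (X Y : rspace) (f : rmor X Y) (V : opens Y) : opens X :=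
  opens_pre (@rcont _ _ f) V.
Lemma rpre_sub (X Y : rspace) (f : rmor X Y) (V : opens Y) :
  rpre f V `<=` f @^-1` V.
Proof. by []. Qed.
Arguments rpre_sub {X Y f V}.

Definition rmor_eq (X Y : rspace) (f g : rmor X Y) : Prop :=
  (forall p, f p = g p) /\
  (forall (V : opens Y) (U : opens X) (hf : U `<=` f @^-1` V)
    (hg : U `<=` g @^-1` V) s, sharp hf s = sharp hg s).

Definition rid (X : rspace) : rmor X X.
Proof.
apply: (@RMor X X idfun (fun p => cvg_id) (fun V U h => res h)).
move=> V V' U U' hV hU h h' s.
have k : U' `<=` V by move=> x /hU /h.
by rewrite !(res_comp _ _ k).
Defined.

Section Comp.
Variables (X Y Z : rspace) (g : rmor Y Z) (f : rmor X Y).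
Lemma rcomp_cont : continuous (g \o f).
Proof. by move=> x; apply: continuous_comp; apply: rcont. Qed.

Definition rcomp_sharp (W : opens Z) (U : opens X) (h : U `<=` (g \o f) @^-1` W) :
    {rmorphism sec Z W -> sec X U} :=
  sharp (h : U `<=` f @^-1` (rpre g W)) \o sharp (rpre_sub : rpre g W `<=` g @^-1` W).

Lemma rcomp_sharp_res (V V' : opens Z) (U U' : opens X) (hV : V' `<=` V)
    (hU : U' `<=` U) (h : U `<=` (g \o f) @^-1` V) (h' : U' `<=` (g \o f) @^-1` V') s :
  res hU (rcomp_sharp h s) = rcomp_sharp h' (res hV s).
Proof.
have k : rpre g V' `<=` rpre g V by move=> y /hV.
rewrite /= (sharp_res k hU _ (h' : U' `<=` f @^-1` (rpre g V'))).
by rewrite (sharp_res hV k _ rpre_sub).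
Qed.

Definition rcomp : rmor X Z := RMor rcomp_cont rcomp_sharp_res.
End Comp.

Section GermMap.
Variables (X Y : rspace) (f : rmor X Y) (BX : direction X) (BY : direction Y).
Hypothesis hf : forall V, BY V -> BX (rpre f V).

Definition germ_map_rep (a : gcar BY) : germs BX := germ (hf (gB a))
  (sharp rpre_sub (gs a)).

Lemma germ_map_op (op : forall U, sec Y U -> sec Y U -> sec Y U)
    (a b : gcar BY) (oX : forall U, sec X U -> sec X U -> sec X U) :
    (forall (U : opens X) (V : opens Y) (h : U `<=` f @^-1` V) s t,
      sharp h (op V s t) = oX U (sharp h s) (sharp h t)) ->
    (forall (U V : opens X) (h : U `<=` V) s t,
      res h (oX V s t) = oX U (res h s) (res h t)) ->
  germ_map_rep (gop2 op a b) = @cls (germ_pre BX) (gop2 oX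
    (GCar (hf (gB a)) (sharp rpre_sub (gs a)))
    (GCar (hf (gB b)) (sharp rpre_sub (gs b)))).
Proof.
move=> h1 h2; apply/clsP.
set U := rpre f (opensI (gU a) (gU b)).
have kU : U `<=` opensI (rpre f (gU a)) (rpre f (gU b)) by [].
exists U, (hf (dirI (gB a) (gB b))), opens_refl, kU => /=.
rewrite h1 !h2.
have ka : U `<=` rpre f (gU a) by move=> x [].
have kb : U `<=` rpre f (gU b) by move=> x [].
rewrite (res_comp _ _ ka) (res_comp _ _ kb) !res_id.
congr (oX _ _ _).
- by rewrite (sharp_res (@opensIl _ (gU a) (gU b)) ka _ rpre_sub).
- by rewrite (sharp_res (@opensIr _ (gU a) (gU b)) kb _ rpre_sub).
Qed.

Definition germ_map : {rmorphism germs BY -> germs BX}.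
Proof.
apply: (@quo_lift (germ_pre BY) _ germ_map_rep).
- move=> a b [W [hW [h1 [h2 e]]]]; apply/germP.
  have k1 : rpre f W `<=` opens_pre (@rcont _ _ f) (gU a) by move=> x /h1.
  have k2 : rpre f W `<=` opens_pre (@rcont _ _ f) (gU b) by move=> x /h2.
  exists (rpre f W), (hf hW), k1, k2.
  rewrite (sharp_res h1 k1 _ rpre_sub) e.
  by rewrite -(sharp_res h2 k2 rpre_sub).
- by rewrite /germ_map_rep /= rmorph1 -to_germsE rmorph1.
- move=> a b; rewrite (@germ_map_op _ a b (fun U s t => s + t)) ?clsD //.
  + by move=> *; rewrite rmorphD.
  + by move=> *; rewrite rmorphD.
- move=> a b; rewrite (@germ_map_op _ a b (fun U s t => s * t)) ?clsM //.
  + by move=> *; rewrite rmorphM.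
  + by move=> *; rewrite rmorphM.
Defined.

Lemma germ_mapE (V : opens Y) (U : opens X) (hV : BY V) (hU : BX U)
    (h : U `<=` f @^-1` V) s : germ_map (germ hV s) = germ hU (sharp h s).
Proof.
rewrite /germ_map quo_liftE /=; apply/germP.
have k : U `<=` rpre f V by [].
exists U, hU, k, opens_refl.
by rewrite (sharp_res opens_refl k _ h) !res_id.
Qed.
End GermMap.

Definition stalk_map (X Y : rspace) (f : rmor X Y) (p : X) :
  {rmorphism stalk (f p) -> stalk p} :=
  @germ_map X Y f (dnbhs p) (dnbhs (f p)) (fun V hV => hV).

(* Zariski topology: the open sets are the unions of sets D(f). *)
Section SpecTopology.
Variable A : comPzRingType.
HB.instance Definition _ := gen_eqMixin (spec A).
HB.instance Definition _ := gen_choiceMixin (spec A).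
Definition zopen : set_system (spec A) :=
  fun U => forall p, U p -> exists2 f, ~ p f & forall q : spec A, ~ q f -> U q.
Let zopenT : zopen setT.
Proof. by move=> p _; exists 1 => //; apply: spec1. Qed.
Let zopenI : setI_closed zopen.
Proof.
move=> U V hU hV p [/hU[f hf fU] /hV[g hg gV]]; exists (f * g).
  exact: specNM.
move=> q hq; split; [apply: fU|apply: gV] => hh; apply: hq.
  by rewrite mulrC; apply: specMl.
exact: specMl.
Qed.
Let zopenU (I : Type) (f : I -> set (spec A)) :
  (forall i, zopen (f i)) -> zopen (\bigcup_i f i).
Proof.
move=> hf p [i _ /hf[g hg h]]; exists g => // q hq; exists i => //; exact: h.
Qed.
HB.instance Definition _ := isOpenTopological.Build (spec A) zopenT zopenI zopenU.

Lemma zopenE (U : set (spec A)) : open U = zopen U.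
Proof. by []. Qed.
End SpecTopology.

Section StructureSheaf.
Variable A : comPzRingType.
Implicit Types (U V : opens (spec A)).

Definition loc_prod U : comPzRingType :=
  dprod (fun q : {q : spec A | oset U q} => loc (sval q)).

(* Locally, [f] is a quotient a / b: the equation f = a / b is written
   f * b = a, where b is a unit. *)
Definition loc_frac U (f : loc_prod U) : Prop :=
  forall p : {p : spec A | oset U p}, exists (W : opens (spec A)) (a b : A),
    oset W (sval p) /\ forall r : {q : spec A | oset U q}, oset W (sval r) ->
      ~ sval r b /\ f r * to_loc (sval r) b = to_loc (sval r) a.

Definition spec_subring U : subring (loc_prod U).
Proof.
apply: (@Subring _ (@loc_frac U)).
- move=> p; exists U, 1, 1; split; first exact: (svalP p).
  by move=> r _; split; [exact: spec1|rewrite rmorph1 mulr1].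
- move=> f g hf hg p; have [W [a [b [Wp h]]]] := hf p.
  have [W' [a' [b' [W'p h']]]] := hg p.
  exists (opensI W W'), (a * b' - a' * b), (b * b'); split=> // r [Wr W'r].
  have [hb e] := h r Wr; have [hb' e'] := h' r W'r.
  split; first exact: specNM.
  rewrite rmorphB !rmorphM -e -e' /=.
  have -> : (f - g) r = f r - g r by [].
  by ring.
- move=> f g hf hg p; have [W [a [b [Wp h]]]] := hf p.
  have [W' [a' [b' [W'p h']]]] := hg p.
  exists (opensI W W'), (a * a'), (b * b'); split=> // r [Wr W'r].
  have [hb e] := h r Wr; have [hb' e'] := h' r W'r.
  split; first exact: specNM.
  rewrite !rmorphM -e -e' /=.
  have -> : (f * g) r = f r * g r by [].
  by ring.
Defined.

Definition spec_sec U : comPzRingType := sub_ring (spec_subring U).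

Definition sval_at U (s : spec_sec U) (q : spec A) (h : oset U q) : loc q :=
  (val s : loc_prod U) (exist _ q h).

Lemma sval_at_rmorph U (q : spec A) (h : oset U q) :
  [/\ sval_at (1 : spec_sec U) h = 1,
    forall s t : spec_sec U, sval_at (s + t) h = sval_at s h + sval_at t h,
    forall s t : spec_sec U, sval_at (s - t) h = sval_at s h - sval_at t h &
    forall s t : spec_sec U, sval_at (s * t) h = sval_at s h * sval_at t h].
Proof. by []. Qed.

Lemma spec_sec_ext U (s t : spec_sec U) :
  (forall q (h : oset U q), sval_at s h = sval_at t h) -> s = t.
Proof.
move=> e; apply: val_inj; apply: functional_extensionality_dep => -[q h].
exact: e.
Qed.

Lemma spec_secP U (s : spec_sec U) p (h : oset U p) :
  exists (W : opens (spec A)) (a b : A), [/\ oset W p, W `<=` U &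
    forall r (hr : oset U r), oset W r ->
      ~ r b /\ sval_at s hr * to_loc r b = to_loc r a].
Proof.
have [W [a [b [Wp e]]]] := subP s (exist _ p h).
exists (opensI W U), a, b; split=> //; first by move=> x [].
by move=> r hr [Wr _]; exact: e (exist _ r hr) Wr.
Qed.

Definition mksec U (f : forall q, oset U q -> loc q)
    (hf : forall p, oset U p -> exists (W : opens (spec A)) (a b : A),
      oset W p /\ forall r (hr : oset U r), oset W r ->
        ~ r b /\ f r hr * to_loc r b = to_loc r a) : spec_sec U.
Proof.
apply: (@mksub _ (spec_subring U) (fun q => f (sval q) (proj2_sig q))).
move=> [p hp]; have [W [a [b [Wp h]]]] := hf p hp.
by exists W, a, b; split=> // -[r hr] /= Wr; exact: h.
Defined.

Lemma mksecE U f hf q (h : oset U q) : sval_at (@mksec U f hf) h = f q h.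
Proof. by []. Qed.

Lemma spec_res_subproof U V (hUV : U `<=` V) (s : spec_sec V) p (hp : oset U p) :
  exists (W : opens (spec A)) (a b : A),
    oset W p /\ forall r (hr : oset U r), oset W r ->
      ~ r b /\ sval_at s (hUV r hr) * to_loc r b = to_loc r a.
Proof.
have [W [a [b [Wp WV h]]]] := spec_secP s (hUV p hp).
by exists W, a, b; split=> // r hr; exact: h.
Qed.

Definition spec_res U V (hUV : U `<=` V) : {rmorphism spec_sec V -> spec_sec U}.
Proof.
apply: (@mk_rmorphism _ _ (fun s => mksec (@spec_res_subproof U V hUV s))).
- by apply: spec_sec_ext.
- by move=> s t; apply: spec_sec_ext.
- by move=> s t; apply: spec_sec_ext.
Defined.

Lemma spec_resE U V (hUV : U `<=` V) s q (h : oset U q) :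
  sval_at (spec_res hUV s) h = sval_at s (hUV q h).
Proof. by []. Qed.

Lemma sval_at_pi U (s : spec_sec U) q (h h' : oset U q) : sval_at s h = sval_at s h'.
Proof. by rewrite (Prop_irrelevance h h'). Qed.

Definition frac_sec U (a b : A) (hb : forall q, oset U q -> ~ q b) : spec_sec U.
Proof.
apply: (@mksec U (fun q h => frac a (hb q h))) => p hp.
by exists U, a, b; split=> // r hr _; split; [exact: hb|rewrite frac_mul].
Defined.

Lemma spec_cst_subproof U (a : A) p (hp : oset U p) :
  exists (W : opens (spec A)) (c b : A),
    oset W p /\ forall r (hr : oset U r), oset W r ->
      ~ r b /\ to_loc r a * to_loc r b = to_loc r c.
Proof.
exists U, a, 1; split=> // r hr _.
by split; [exact: spec1|rewrite rmorph1 mulr1].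
Qed.

Definition spec_cst U : {rmorphism A -> spec_sec U}.
Proof.
apply: (@mk_rmorphism _ _ (fun a => mksec (@spec_cst_subproof U a))).
- by apply: spec_sec_ext => q h; rewrite mksecE rmorph1.
- by move=> a b; apply: spec_sec_ext => q h; rewrite mksecE rmorphD.
- by move=> a b; apply: spec_sec_ext => q h; rewrite mksecE rmorphM.
Defined.

Lemma spec_cstE U a q (h : oset U q) : sval_at (spec_cst U a) h = to_loc q a.
Proof. by []. Qed.
End StructureSheaf.

Definition SpecR (A : comPzRingType) : rspace.
Proof.
apply: (@RSpace (spec A) (@spec_sec A) (@spec_res A)).
- by move=> U h s; apply: spec_sec_ext => q hq; rewrite spec_resE; apply: sval_at_pi.
- move=> U V W h1 h2 h3 s; apply: spec_sec_ext => q hq.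
  by rewrite (spec_resE h1) (spec_resE h2) (spec_resE h3); apply: sval_at_pi.
Defined.

Lemma SpecR_sheaf (A : comPzRingType) : is_sheaf (SpecR A).
Proof.
split=> I U V hU cov.
  move=> s t e; apply: spec_sec_ext => q hq; have [i _ hi] := cov q hq.
  have := congr1 (fun z : spec_sec (U i) => sval_at z hi) (e i).
  by rewrite /= !spec_resE (sval_at_pi s _ hq) (sval_at_pi t _ hq).
move=> s agree.
have pick q (hq : oset V q) : {i | oset (U i) q}.
  by apply: cid; have [i _ hi] := cov q hq; exists i.
have agr i j q (hi : oset (U i) q) (hj : oset (U j) q) :
    sval_at (s i : spec_sec (U i)) hi = sval_at (s j : spec_sec (U j)) hj.
  have := congr1 (fun z : spec_sec (opensI (U i) (U j)) => sval_at z (conj hi hj))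
    (agree i j (opensI (U i) (U j)) (@opensIl _ _ _) (@opensIr _ _ _)).
  by rewrite /= !spec_resE (sval_at_pi _ _ hi) (sval_at_pi _ _ hj).
pose f q (hq : oset V q) : loc q := sval_at (s (sval (pick q hq)) : spec_sec _) (svalP (pick q hq)).
have hf p : oset V p -> exists (W : opens (spec A)) (a b : A),
      oset W p /\ forall r (hr : oset V r), oset W r ->
        ~ r b /\ f r hr * to_loc r b = to_loc r a.
  move=> hp; have [i hi] := pick p hp.
  have [W [a [b [Wp WU h]]]] := spec_secP (s i : spec_sec (U i)) hi.
  exists W, a, b; split=> // r hr Wr.
  by rewrite /f (agr _ _ _ _ (WU r Wr)); apply: h.
exists (mksec hf) => i; apply: spec_sec_ext => q hq.
by rewrite spec_resE mksecE; apply: agr.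
Qed.

Definition is_local (L : comPzRingType) : Prop :=
  1 <> 0 :> L /\ forall a b : L, is_unit (a + b) -> is_unit a \/ is_unit b.

Lemma loc_is_local (A : comPzRingType) (p : spec A) : is_local (loc p).
Proof.
split; first exact: loc1_neq0.
move=> x y; have [a [s [hs ->]]] := fracP x; have [b [t [ht ->]]] := fracP y.
have -> : frac a hs + frac b ht = frac (a * t + b * s) (specNM hs ht).
  by rewrite -clsD; apply/clsP; exists 1; [exact: spec1|rewrite /=; ring].
move=> /unit_fracP hn; rewrite !unit_fracP; apply: contrapT => /not_orP[].
move=> /contrapT ha /contrapT hb; apply: hn.
by apply: specD; rewrite mulrC; apply: specMl.
Qed.

Lemma spec_germ_unit (A : comPzRingType) (p : SpecR A) (U : opens (SpecR A))
    (hU : dnbhs p U) (s : sec (SpecR A) U) :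
  is_unit (germ hU s : stalk p) <-> is_unit (sval_at (s : spec_sec U) hU).
Proof.
split=> [[x]|].
  have [V [hV [t ->]]] := germE x.
  pose W := opensI U V; have hW : dnbhs p W by split.
  rewrite -(germ_res hW hU (@opensIl _ U V)) -(germ_res hW hV (@opensIr _ U V)).
  rewrite -germM -(germ1 hW) => /germP[W' [hW' [h1 [h2 e]]]].
  exists (sval_at (t : spec_sec V) hV).
  have := congr1 (fun z : spec_sec W' => sval_at z hW') e.
  rewrite !spec_resE; have [_ _ _ ->] := sval_at_rmorph (h1 p hW').
  have [-> _ _ _] := sval_at_rmorph (h2 p hW').
  by rewrite !spec_resE (sval_at_pi s _ hU) (sval_at_pi t _ hV).
move=> su; have [W [a [b [Wp WU h]]]] := spec_secP (s : spec_sec U) hU.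
have [hb e] := h p hU Wp.
have ha : ~ p a.
  apply/(unit_fracP (p := p) a (@spec1 A p)).
  have [u eu] := su; have [v ev] := to_loc_unit hb.
  exists (u * v); rewrite -[frac a _]/(to_loc p a) -e.
  by rewrite mulrACA eu ev mulr1.
have oD : open ([set q : spec A | ~ q a]).
  by rewrite zopenE => q hq; exists a.
pose W' : opens (SpecR A) := opensI W (Opens oD).
have hW' : dnbhs p W' by split.
have hn (q : spec A) : oset W' q -> ~ q a by case.
have W'U : W' `<=` U by move=> q [/WU].
exists (germ hW' (frac_sec b hn : sec (SpecR A) W')).
rewrite -(germ_res hW' hU W'U) -germM -(germ1 hW').
congr (germ _ _); apply: spec_sec_ext => q hq.
have [-> _ _ ->] := sval_at_rmorph hq.
rewrite spec_resE mksecE.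
have [hqb eq] := h q (W'U q hq) hq.1.
apply: (unit_mulI (to_loc_unit hqb)); rewrite mul1r mulrAC eq mulrC.
by rewrite frac_mul.
Qed.

Lemma SpecR_local (A : comPzRingType) (p : SpecR A) : is_local (stalk p).
Proof.
split.
  move=> e; pose T := opensT (SpecR A); have hT : dnbhs p T by [].
  have [hu _] := @spec_germ_unit A p T hT 0.
  have [|x] := hu; first by rewrite germ0 -e; exists 1; rewrite mulr1.
  have -> : sval_at (0 : spec_sec T) hT = 0 by [].
  by rewrite mul0r => /esym; apply: loc1_neq0.
move=> x y; have [U [hU [s ->]]] := germE x; have [V [hV [t ->]]] := germE y.
have hW : dnbhs p (opensI U V) by split.
rewrite -(germ_res hW hU (@opensIl _ U V)) -(germ_res hW hV (@opensIr _ U V)).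
rewrite -germD => /spec_germ_unit; have [_ -> _ _] := sval_at_rmorph hW.
by move=> /(loc_is_local p).2[] h; [left|right]; apply/spec_germ_unit.
Qed.

Section SpecMap.
Variables (A B : comPzRingType) (phi : {rmorphism A -> B}).

Definition comap (q : spec B) : spec A.
Proof.
apply: (@MkSpec A (fun a => q (phi a))).
- by rewrite rmorph0; apply: spec0.
- by move=> a b ha hb; rewrite rmorphD; apply: specD.
- by move=> a b hb; rewrite rmorphM; apply: specMl.
- by rewrite rmorph1; apply: spec1.
- by move=> a b; rewrite rmorphM; apply: specM.
Defined.

Definition loc_map_rep (q : spec B) (x : loc_pre (comap q)) : loc q :=
  frac (phi x.1) (svalP x.2 : ~ q (phi (sval x.2))).

Definition loc_map (q : spec B) : {rmorphism loc (comap q) -> loc q}.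
Proof.
apply: (@quo_lift (loc_pre (comap q)) _ (@loc_map_rep q)).
- move=> x y [u hu e]; apply/frac_eq; exists (phi u) => //.
  by rewrite -!rmorphM e.
- rewrite /loc_map_rep -cls1; apply/clsP; exists 1; first exact: spec1.
  by rewrite /= !rmorph1.
- move=> x y; rewrite -clsD; apply/clsP; exists 1; first exact: spec1.
  by rewrite /= !(rmorphD, rmorphM).
- move=> x y; rewrite -clsM; apply/clsP; exists 1; first exact: spec1.
  by rewrite /= !rmorphM.
Defined.

Lemma loc_map_frac q a s (hs : ~ comap q s) :
  loc_map q (frac a hs) = frac (phi a) (hs : ~ q (phi s)).
Proof.
rewrite /loc_map quo_liftE; apply/frac_eq; exists 1 => //; exact: spec1.
Qed.

Lemma loc_map_to_loc q a : loc_map q (to_loc (comap q) a) = to_loc q (phi a).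
Proof.
rewrite loc_map_frac; apply/frac_eq; exists 1; first exact: spec1.
by rewrite rmorph1.
Qed.

Let comap_cont : continuous (comap : SpecR B -> SpecR A).
Proof.
apply/continuousP => U; rewrite !zopenE => oU q /oU[f hf fU].
by exists (phi f) => // r hr; apply: fU.
Qed.

Lemma spec_sharp_subproof (V : opens (SpecR A)) (U : opens (SpecR B))
    (h : U `<=` comap @^-1` V) (s : spec_sec V) p (hp : oset U p) :
  exists (W : opens (spec B)) (a b : B),
    oset W p /\ forall r (hr : oset U r), oset W r ->
      ~ r b /\ loc_map r (sval_at s (h r hr)) * to_loc r b = to_loc r a.
Proof.
have [W [a [b [Wp WV e]]]] := spec_secP s (h p hp).
exists (opens_pre comap_cont W), (phi a), (phi b); split=> // r hr Wr.
have [hb er] := e (comap r) (h r hr) Wr.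
by split=> //; rewrite -!loc_map_to_loc -rmorphM er.
Qed.

Section SpecSharp.
Variables (V : opens (SpecR A)) (U : opens (SpecR B)) (h : U `<=` comap @^-1` V).
Let f (s : spec_sec V) : spec_sec U := mksec (spec_sharp_subproof h s).
Let f1 : f 1 = 1.
Proof.
apply: spec_sec_ext => q hq; have [e _ _ _] := sval_at_rmorph (@h q hq).
have [e' _ _ _] := sval_at_rmorph hq.
by apply: etrans (esym e'); rewrite mksecE e rmorph1.
Qed.
Let fD s t : f (s + t) = f s + f t.
Proof.
apply: spec_sec_ext => q hq; have [_ e _ _] := sval_at_rmorph (@h q hq).
have [_ e' _ _] := sval_at_rmorph hq.
by apply: etrans (esym (e' _ _)); rewrite !mksecE e rmorphD.
Qed.
Let fM s t : f (s * t) = f s * f t.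
Proof.
apply: spec_sec_ext => q hq; have [_ _ _ e] := sval_at_rmorph (@h q hq).
have [_ _ _ e'] := sval_at_rmorph hq.
by apply: etrans (esym (e' _ _)); rewrite !mksecE e rmorphM.
Qed.
Definition spec_sharp : {rmorphism sec (SpecR A) V -> sec (SpecR B) U} :=
  mk_rmorphism f1 fD fM.
End SpecSharp.

Lemma spec_sharpE V U h s q hq :
  sval_at (@spec_sharp V U h s : spec_sec U) hq = loc_map q (sval_at (s : spec_sec V) (h q hq)).
Proof. by []. Qed.

Lemma spec_sharp_res (V V' : opens (SpecR A)) (U U' : opens (SpecR B))
  (hV : V' `<=` V) (hU : U' `<=` U) (h : U `<=` comap @^-1` V)
  (h' : U' `<=` comap @^-1` V') s :
  spec_res hU (spec_sharp h s) = spec_sharp h' (spec_res hV s).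
Proof.
apply: spec_sec_ext => q hq.
rewrite spec_resE !spec_sharpE spec_resE; congr (loc_map q _); exact: sval_at_pi.
Qed.

Definition spec_mapR : rmor (SpecR B) (SpecR A) :=
  @RMor (SpecR B) (SpecR A) comap comap_cont spec_sharp spec_sharp_res.
End SpecMap.

(* [f] restricts to an isomorphism of ringed spaces from the open subspace W
   onto the open subspace V: a homeomorphism W -> V such that the maps
   O_Y(V') -> O_X(W /\ f^-1 V') are isomorphisms for V' contained in V. *)
Definition iso_on (X Y : rspace) (f : rmor X Y) (W : opens X) (V : opens Y) : Prop :=
  [/\ f @` W = V,
    forall p q : X, oset W p -> oset W q -> f p = f q -> p = q,
    forall W' : opens X, W' `<=` W -> open (f @` W') &
    forall V' : opens Y, V' `<=` V ->
      bijective (sharp (@opensIr _ W (rpre f V') : _ `<=` f @^-1` V'))].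

(* There is an isomorphism of ringed spaces from a spectrum onto U; it is
   automatically an isomorphism of locally ringed spaces. *)
Definition affine_open (X : rspace) (U : opens X) : Prop :=
  exists (A : comPzRingType) (j : rmor (SpecR A) X), iso_on j (opensT _) U.

Record scheme := Scheme {
  srs :> rspace;
  s_sheaf : is_sheaf srs;
  s_local : forall p : srs, is_local (stalk p);
  s_affine : forall p : srs, exists2 U : opens srs, oset U p & affine_open U }.

Lemma iso_on_id (X : rspace) : iso_on (rid X) (opensT X) (opensT X).
Proof.
split.
- by apply/seteqP; split=> [x []|x _] //; exists x.
- by [].
- move=> W _; have -> : rid X @` W = W; last exact: oopen.
  by apply/seteqP; split=> [x [y Wy <-]|x Wx] //; exists x.
move=> V _; have hV : V `<=` opensI (opensT X) (rpre (rid X) V) by [].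
have hV' : opensI (opensT X) (rpre (rid X) V) `<=` V by move=> x [].
exists (res hV) => s.
- exact: etrans (res_comp _ _ opens_refl s) (res_id _ s).
- exact: etrans (res_comp _ _ opens_refl s) (res_id _ s).
Qed.

Lemma SpecR_affine (A : comPzRingType) : affine_open (opensT (SpecR A)).
Proof. by exists A, (rid _); exact: iso_on_id. Qed.

Definition Spec (A : comPzRingType) : scheme :=
  @Scheme (SpecR A) (@SpecR_sheaf A) (@SpecR_local A)
    (fun p => ex_intro2 _ _ (opensT (SpecR A)) I (SpecR_affine A)).

Lemma stalk_mapE (X Y : rspace) (f : rmor X Y) (p : X) (V : opens Y) (U : opens X)
    (hV : dnbhs (f p) V) (hU : dnbhs p U) (h : U `<=` f @^-1` V) s :
  stalk_map f p (germ hV s) = germ hU (sharp h s).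
Proof. exact: germ_mapE. Qed.

(* Morphisms of schemes: the maps on stalks are local. *)
Record smor (X Y : scheme) := SMor {
  smr :> rmor X Y;
  smr_local : forall (p : X) (a : stalk (smr p)),
    is_unit (stalk_map smr p a) -> is_unit a }.

Definition smor_eq (X Y : scheme) (f g : smor X Y) : Prop := rmor_eq f g.

Definition sid (X : scheme) : smor X X.
Proof.
apply: (@SMor X X (rid X)) => p a.
have [U [hU [s ->]]] := germE a.
have hh : U `<=` rid X @^-1` U by [].
have -> // : stalk_map (rid X) p (germ hU s) = germ hU s.
apply: etrans (stalk_mapE hU (hU : dnbhs p U) hh s) _.
by congr (germ _ _); apply: res_id.
Defined.

Lemma stalk_map_comp (X Y Z : rspace) (g : rmor Y Z) (f : rmor X Y) (p : X)
    (a : stalk (g (f p))) :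
  stalk_map (rcomp g f) p a = stalk_map f p (stalk_map g (f p) a).
Proof.
have [U [hU [s ->]]] := germE a.
have hgU : dnbhs (f p) (rpre g U) := hU.
have hfgU : dnbhs p (rpre f (rpre g U)) := hU.
have e1 := stalk_mapE hU hgU rpre_sub s.
have e2 := stalk_mapE hgU hfgU rpre_sub (sharp rpre_sub s).
have e3 := @stalk_mapE _ _ (rcomp g f) p U _ hU hfgU
  (rpre_sub : rpre f (rpre g U) `<=` f @^-1` (rpre g U)) s.
by rewrite e3 e1 e2.
Qed.

Definition scomp (X Y Z : scheme) (g : smor Y Z) (f : smor X Y) : smor X Z.
Proof.
apply: (@SMor X Z (rcomp g f)) => p a; rewrite stalk_map_comp => h.
by apply: (smr_local (s := g)); apply: (smr_local (s := f)).
Defined.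

Definition spec_map (A B : comPzRingType) (phi : {rmorphism A -> B}) :
  smor (Spec B) (Spec A).
Proof.
apply: (@SMor (Spec B) (Spec A) (spec_mapR phi)) => q a.
have [U [hU [s ->]]] := germE a.
rewrite (stalk_mapE hU (hU : dnbhs (q : SpecR B) (rpre (spec_mapR phi) U)) rpre_sub).
move=> /spec_germ_unit h; apply/spec_germ_unit.
have e : loc_map phi q (sval_at (s : spec_sec U) hU) =
  sval_at (sharp (rpre_sub : rpre (spec_mapR phi) U `<=` _) s : spec_sec (rpre (spec_mapR phi) U))
   (hU : dnbhs (q : SpecR B) (rpre (spec_mapR phi) U)).
  by rewrite spec_sharpE (sval_at_pi s _ hU).
rewrite -e in h; move: h.
have [b [t [ht ->]]] := fracP (sval_at (s : spec_sec U) hU).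
by rewrite loc_map_frac !unit_fracP.
Defined.

Definition is_pullback (X Y Z P : scheme) (f : smor X Z) (g : smor Y Z)
    (p1 : smor P X) (p2 : smor P Y) : Prop :=
  smor_eq (scomp f p1) (scomp g p2) /\
  forall (T : scheme) (a : smor T X) (b : smor T Y),
    smor_eq (scomp f a) (scomp g b) ->
    exists u : smor T P, [/\ smor_eq (scomp p1 u) a, smor_eq (scomp p2 u) b &
      forall u' : smor T P, smor_eq (scomp p1 u') a -> smor_eq (scomp p2 u') b ->
        smor_eq u' u].

Definition closed_map (X Y : topologicalType) (f : X -> Y) : Prop :=
  forall C : set X, closed C -> closed (f @` C).

(* A homeomorphism onto a closed subset, which is surjective on stalks. *)
Definition closed_immersion (X Y : scheme) (f : smor X Y) : Prop :=
  [/\ injective f, closed_map f &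
    forall (p : X) (b : stalk p), exists a, stalk_map f p a = b].

(* The diagonal d : X -> X *_Y X is a closed immersion. The fibre product is
   given by its universal property; it exists and is unique up to isomorphism,
   and so are those in [universally_closed]. *)
Definition separated (X Y : scheme) (f : smor X Y) : Prop :=
  forall (P : scheme) (p1 p2 : smor P X) (d : smor X P),
    is_pullback f f p1 p2 ->
    smor_eq (scomp p1 d) (sid X) -> smor_eq (scomp p2 d) (sid X) ->
    closed_immersion d.

Definition universally_closed (X Y : scheme) (f : smor X Y) : Prop :=
  forall (Z P : scheme) (g : smor Z Y) (p1 : smor P X) (p2 : smor P Z),
    is_pullback f g p1 p2 -> closed_map p2.

(* B is generated by finitely many elements as an algebra over A. *)
Definition finite_type_ring (A B : comPzRingType) (phi : {rmorphism A -> B}) : Prop :=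
  exists (n : nat) (b : 'I_n -> B), forall S : subring B,
    (forall a, S (phi a)) -> (forall i, S (b i)) -> forall c, S c.

Definition quasi_compact (X Y : scheme) (f : smor X Y) : Prop :=
  forall V : opens Y, compact V -> compact (f @^-1` V).

Definition finite_type (X Y : scheme) (f : smor X Y) : Prop :=
  quasi_compact f /\
  forall p : X, exists (U : opens X) (V : opens Y) (h : U `<=` f @^-1` V),
    [/\ oset U p, affine_open U, affine_open V & finite_type_ring (sharp h)].

Definition proper (X Y : scheme) (f : smor X Y) : Prop :=
  [/\ separated f, finite_type f & universally_closed f].

Definition reduced (X : scheme) : Prop :=
  forall (U : opens X) (s : sec X U) (n : nat), s ^+ n = 0 -> s = 0.

Definition irreducible (X : scheme) : Prop :=
  [set: X] !=set0 /\
  forall U V : opens X, U !=set0 -> V !=set0 -> (U `&` V) !=set0.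

Definition integral_scheme (X : scheme) : Prop := irreducible X /\ reduced X.

Record variety (k : fieldType) := Variety {
  vsch :> scheme;
  vstr : smor vsch (Spec k);
  v_integral : integral_scheme vsch;
  v_separated : separated vstr;
  v_finite_type : finite_type vstr }.

Definition over_base (k : fieldType) (X Y : variety k) (f : smor X Y) : Prop :=
  smor_eq (scomp (vstr Y) f) (vstr X).

(* The nonempty open sets are the neighbourhoods of the generic point, so
   [function_field] is the local ring at the generic point. *)
Definition dgen (k : fieldType) (X : variety k) : direction X.
Proof.
apply: (@Direction X (fun U => U !=set0)).
- exact: (v_integral X).1.1.
- exact: (v_integral X).1.2.
Defined.

Definition function_field (k : fieldType) (X : variety k) : comPzRingType :=
  germs (dgen X).

Lemma pre_opensT (X Y : topologicalType) (f : X -> Y) (U : opens X) :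
  U `<=` f @^-1` (opensT Y).
Proof. by []. Qed.

Definition base_sec (k : fieldType) (X : variety k) (U : opens X) :
    {rmorphism k -> sec X U} :=
  sharp (@pre_opensT _ _ (vstr X) U)
  \o spec_cst (opensT (SpecR k)).

Definition base_ff (k : fieldType) (X : variety k) :
    {rmorphism k -> function_field X} :=
  to_germs (dirT (dgen X)) \o base_sec (opensT X).

Definition dominant (X Y : scheme) (f : smor X Y) : Prop :=
  forall V : opens Y, V !=set0 -> (rpre f V) !=set0.

Definition ff_map (k : fieldType) (X Y : variety k) (f : smor X Y)
    (hf : dominant f) : {rmorphism function_field Y -> function_field X} :=
  @germ_map X Y f (dgen X) (dgen Y) hf.

Definition birational (k : fieldType) (X Y : variety k) (f : smor X Y) : Prop :=
  exists (W : opens X) (V : opens Y), [/\ W !=set0, V !=set0 & iso_on f W V].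

Section PrimeQuotient.
Variables (A : comPzRingType) (p : spec A).
Lemma specN a : p a -> p (- a).
Proof. by move=> h; rewrite -mulN1r; apply: specMl. Qed.

Definition quot_pre : preRing.
Proof.
apply: (@PreRing A (fun a b => p (a - b)) 0 1 -%R +%R *%R).
- by move=> a; rewrite subrr; apply: spec0.
- by move=> a b /specN; rewrite opprB.
- by move=> a b c h1 h2; have := specD h1 h2; rewrite addrA subrK.
- by move=> a b /specN; rewrite opprD.
- by move=> a b c d h1 h2; have := specD h1 h2; rewrite opprD addrACA.
- move=> a b c d h1 h2; have := specD (specMl c h1) (specMl b h2).
  by rewrite (_ : c * (a - b) + b * (c - d) = a * c - b * d) //; ring.
- by move=> a b c; rewrite addrA subrr; apply: spec0.
- by move=> a b; rewrite [a + b]addrC subrr; apply: spec0.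
- by move=> a; rewrite add0r subrr; apply: spec0.
- by move=> a; rewrite addNr subrr; apply: spec0.
- by move=> a b c; rewrite mulrA subrr; apply: spec0.
- by move=> a b; rewrite [a * b]mulrC subrr; apply: spec0.
- by move=> a; rewrite mul1r subrr; apply: spec0.
- by move=> a b c; rewrite mulrDl subrr; apply: spec0.
Defined.

Definition prime_quot : comPzRingType := quo quot_pre.

Definition to_quot : {rmorphism A -> prime_quot}.
Proof.
apply: (@mk_rmorphism _ _ (fun a => @cls quot_pre a)) => //.
- by move=> a b; rewrite -clsD.
- by move=> a b; rewrite -clsM.
Defined.

Lemma to_quotP a b : to_quot a = to_quot b <-> p (a - b).
Proof. exact: clsP. Qed.
Lemma to_quot_surj (x : prime_quot) : exists a, x = to_quot a.
Proof. by move: x; apply: quoP => a; exists a. Qed.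
End PrimeQuotient.

Section PrimeQuotMap.
Variables (A B : comPzRingType) (phi : {rmorphism A -> B}) (p : spec A) (q : spec B).
Hypothesis hpq : forall a, p a -> q (phi a).
Definition quot_map : {rmorphism prime_quot p -> prime_quot q}.
Proof.
apply: (@quo_lift (quot_pre p) _ (fun a => to_quot q (phi a))).
- by move=> a b /hpq h; apply/to_quotP; rewrite -rmorphB.
- by rewrite /= !rmorph1.
- by move=> a b; rewrite -!rmorphD.
- by move=> a b; rewrite -!rmorphM.
Defined.
Lemma quot_mapE a : quot_map (to_quot p a) = to_quot q (phi a).
Proof. exact: quo_liftE. Qed.
End PrimeQuotMap.

Section LocalRing.
Variables (L : comPzRingType) (hL : is_local L).
Definition max_ideal : spec L.
Proof.
apply: (@MkSpec L (fun a => ~ is_unit a)).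
- by move=> [b]; rewrite mul0r => /esym; apply: hL.1.
- by move=> a b ha hb /hL.2[].
- by move=> a b hb [c e]; apply: hb; exists (a * c); rewrite -e; ring.
- by apply; exists 1; rewrite mulr1.
- move=> a b h; apply: contrapT => /not_orP[/contrapT[c ec] /contrapT[d ed]].
  by apply: h; exists (c * d); rewrite mulrACA ec ed mulr1.
Defined.
End LocalRing.

Definition residue_field (X : scheme) (p : X) : comPzRingType :=
  prime_quot (max_ideal (s_local p)).

Definition germ_residue (X : scheme) (p : X) (V : opens X) (hV : oset V p) :
    {rmorphism sec X V -> residue_field p} :=
  to_quot _ \o @to_germs X (dnbhs p) V hV.

(* Multiplicative non-Archimedean seminorms on a k-algebra which are trivial
   on k. *)
Record mseminorm (R : realType) (k : fieldType) (L : comPzRingType)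
    (c : {rmorphism k -> L}) := MSeminorm {
  msn :> L -> R;
  msn_ge0 : forall a, 0 <= msn a;
  msn0 : msn 0 = 0;
  msnM : forall a b, msn (a * b) = msn a * msn b;
  msnD : forall a b, msn (a + b) <= Num.max (msn a) (msn b);
  msn_triv : forall a : k, a != 0 -> msn (c a) = 1 }.

Section Seminorm.
Variables (R : realType) (k : fieldType) (L : comPzRingType)
  (c : {rmorphism k -> L}) (z : mseminorm R c).

Lemma msn1 : z 1 = 1.
Proof. by rewrite -(rmorph1 c) msn_triv // oner_eq0. Qed.
Lemma msnN a : z (- a) = z a.
Proof.
rewrite -mulN1r msnM (_ : z (-1) = 1) ?mul1r //.
by rewrite -(rmorphN1 c) msn_triv // oppr_eq0 oner_eq0.
Qed.
Lemma msnB a b : z (a - b) <= Num.max (z a) (z b).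
Proof. by rewrite -(msnN b); apply: msnD. Qed.
Lemma msn_dist a b : `|z a - z b| <= z (a - b).
Proof.
have h u v : z u - z v <= z (u - v).
  rewrite lerBlDr -{1}(subrK v u) (le_trans (msnD z _ _)) //.
  by rewrite ge_max lerDl lerDr !msn_ge0.
by rewrite ler_norml h andbT lerNl opprB -(msnN (a - b)) opprB h.
Qed.
Lemma msn_le1 a : z (c a) <= 1.
Proof.
have [->|a0] := eqVneq a 0; first by rewrite rmorph0 msn0 ler01.
by rewrite msn_triv.
Qed.

(* Completion: Cauchy sequences modulo sequences which tend to zero. *)
Definition cauchy_seq (s : nat -> L) : Prop :=
  forall e : R, 0 < e -> exists N, forall m n, (N <= m)%N -> (N <= n)%N ->
    z (s m - s n) < e.
Definition null_seq (s : nat -> L) : Prop :=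
  forall e : R, 0 < e -> exists N, forall n, (N <= n)%N -> z (s n) < e.
Definition cseq : Type := {s : nat -> L | cauchy_seq s}.

Lemma cauchy_bound s : cauchy_seq s -> exists2 M : R, 0 < M & exists N, forall n,
  (N <= n)%N -> z (s n) <= M.
Proof.
move=> /(_ 1 ltr01)[N h]; exists (z (s N) + 1).
  by rewrite ltr_wpDl // msn_ge0.
exists N => n hn; rewrite -(subrK (s N) (s n)) (le_trans (msnD z _ _)) //.
rewrite ge_max lerDl ler01 andbT (le_trans (ltW (h n N hn (leqnn N)))) //.
by rewrite lerDr msn_ge0.
Qed.

Lemma null_add s t : null_seq s -> null_seq t -> null_seq (fun n => s n + t n).
Proof.
move=> hs ht e e0; have [N h] := hs e e0; have [M h'] := ht e e0.
exists (maxn N M) => n; rewrite geq_max => /andP[h1 h2].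
by rewrite (le_lt_trans (msnD z _ _)) // gt_max h // h'.
Qed.
Lemma null_opp s : null_seq s -> null_seq (fun n => - s n).
Proof. by move=> hs e /hs[N h]; exists N => n /h; rewrite msnN. Qed.
Lemma null_mul s t : cauchy_seq s -> null_seq t -> null_seq (fun n => s n * t n).
Proof.
move=> /cauchy_bound[M M0 [N h]] ht e e0.
have [N' h'] := ht (e / M) (divr_gt0 e0 M0).
exists (maxn N N') => n; rewrite geq_max => /andP[h1 h2].
rewrite msnM (@le_lt_trans _ _ (M * z (t n))) //.
  by rewrite ler_wpM2r ?msn_ge0 ?h.
by rewrite mulrC -ltr_pdivlMr // h'.
Qed.
Lemma null0 : null_seq (fun=> 0).
Proof. by move=> e e0; exists 0%N => n _; rewrite msn0. Qed.
Lemma null_ext s t : s =1 t -> null_seq s -> null_seq t.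
Proof. by move=> /funext ->. Qed.

Lemma cauchy_cst a : cauchy_seq (fun=> a).
Proof. by move=> e e0; exists 0%N => m n _ _; rewrite subrr msn0. Qed.
Lemma cauchy_opp s : cauchy_seq s -> cauchy_seq (fun n => - s n).
Proof.
move=> hs e /hs[N h]; exists N => m n hm hn.
by rewrite -opprD msnN h.
Qed.
Lemma cauchy_add s t : cauchy_seq s -> cauchy_seq t -> cauchy_seq (fun n => s n + t n).
Proof.
move=> hs ht e e0; have [N h] := hs e e0; have [M h'] := ht e e0.
exists (maxn N M) => m n; rewrite !geq_max => /andP[h1 h2] /andP[h3 h4].
by rewrite opprD addrACA (le_lt_trans (msnD z _ _)) // gt_max h // h'.
Qed.
Lemma cauchy_mul s t : cauchy_seq s -> cauchy_seq t -> cauchy_seq (fun n => s n * t n).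
Proof.
move=> hs ht e e0.
have [M M0 [N h]] := cauchy_bound hs; have [M' M'0 [N' h']] := cauchy_bound ht.
have [N1 h1] := hs (e / M') (divr_gt0 e0 M'0).
have [N2 h2] := ht (e / M) (divr_gt0 e0 M0).
exists (maxn (maxn N N') (maxn N1 N2)) => m n.
rewrite !geq_max => /andP[/andP[a1 a2] /andP[a3 a4]] /andP[/andP[b1 b2] /andP[b3 b4]].
have -> : s m * t m - s n * t n = s m * (t m - t n) + (s m - s n) * t n by ring.
rewrite (le_lt_trans (msnD z _ _)) // gt_max !msnM; apply/andP; split.
  rewrite (@le_lt_trans _ _ (M * z (t m - t n))) //.
    by rewrite ler_wpM2r ?msn_ge0 ?h.
  by rewrite mulrC -ltr_pdivlMr // h2.
rewrite (@le_lt_trans _ _ (z (s m - s n) * M')) //.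
  by rewrite ler_wpM2l ?msn_ge0 ?h'.
by rewrite -ltr_pdivlMr // h1.
Qed.

Definition compl_pre : preRing.
Proof.
apply: (@PreRing cseq (fun s t => null_seq (fun n => sval s n - sval t n))
  (exist _ _ (cauchy_cst 0)) (exist _ _ (cauchy_cst 1))
  (fun s => exist _ _ (cauchy_opp (svalP s)))
  (fun s t => exist _ _ (cauchy_add (svalP s) (svalP t)))
  (fun s t => exist _ _ (cauchy_mul (svalP s) (svalP t)))).
- by move=> a; apply: null_ext null0 => n; rewrite subrr.
- by move=> a b /null_opp; apply: null_ext => n; rewrite opprB.
- by move=> a b d h1 h2; apply: null_ext (null_add h1 h2) => n; rewrite addrA subrK.
- by move=> a b /null_opp; apply: null_ext => n; rewrite /= opprD.
- by move=> a b d e h1 h2; apply: null_ext (null_add h1 h2) => n; rewrite /= opprD addrACA.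
- move=> a b d e h1 h2.
  apply: null_ext (null_add (null_mul (svalP d) h1) (null_mul (svalP b) h2)) => n /=.
  ring.
- by move=> a b d; apply: null_ext null0 => n /=; ring.
- by move=> a b; apply: null_ext null0 => n /=; ring.
- by move=> a; apply: null_ext null0 => n /=; ring.
- by move=> a; apply: null_ext null0 => n /=; ring.
- by move=> a b d; apply: null_ext null0 => n /=; ring.
- by move=> a b; apply: null_ext null0 => n /=; ring.
- by move=> a; apply: null_ext null0 => n /=; ring.
- by move=> a b d; apply: null_ext null0 => n /=; ring.
Defined.

Definition compl : comPzRingType := quo compl_pre.

Definition to_compl : {rmorphism L -> compl}.
Proof.
apply: (@mk_rmorphism _ _ (fun a => @cls compl_pre (exist _ _ (cauchy_cst a)))) => //.
- by move=> a b; rewrite -clsD; congr (cls _); apply: sig_inj.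
- by move=> a b; rewrite -clsM; congr (cls _); apply: sig_inj.
Defined.

(* The norm of the completion: the limit of the norms. *)
Definition compl_norm (u : compl) : R :=
  limn (fun n => z (sval (rep u : compl_pre) n)).

Lemma msn_cvg (s : nat -> L) : cauchy_seq s -> cvgn (fun n => z (s n)).
Proof.
move=> hs; apply/cauchy_cvgP/cauchy_exP => e e0.
have [N h] := hs e e0; exists (z (s N)); exists N => // n hn /=.
by rewrite -ball_normE /= (le_lt_trans (msn_dist _ _)) // h.
Qed.

Lemma compl_norm_cvg (s : compl_pre) :
  (fun n => z (sval s n)) @ \oo --> compl_norm (cls s).
Proof.
have hn := rep_cls s; set t := rep (cls s) in hn.
have ht := msn_cvg (svalP t).
have hd : (fun n => z (sval s n) - z (sval t n)) @ \oo --> (0 : R).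
  apply/cvgrPdist_lt => e e0; have [N h] := hn e e0.
  exists N => // n /h hh /=; rewrite sub0r normrN distrC.
  by rewrite (le_lt_trans (msn_dist _ _)).
have -> : (fun n => z (sval s n)) =
  (fun n => z (sval s n) - z (sval t n)) \+ (fun n => z (sval t n)).
  by apply/funext => n /=; rewrite subrK.
by rewrite -[compl_norm _]add0r; apply: cvgD.
Qed.

Lemma compl_normE (s : compl_pre) : compl_norm (cls s) = limn (fun n => z (sval s n)).
Proof. by apply/esym/cvg_lim => //; exact: compl_norm_cvg. Qed.

Lemma compl_norm_to_compl a : compl_norm (to_compl a) = z a.
Proof. by rewrite compl_normE /= lim_cst. Qed.

Lemma compl_normM u v : compl_norm (u * v) = compl_norm u * compl_norm v.
Proof.
move: u v; apply: quoP => s; apply: quoP => t; rewrite -clsM compl_normE.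
apply/cvg_lim => //=; under eq_fun do rewrite msnM.
by apply: cvgM; apply: compl_norm_cvg.
Qed.

Lemma compl_normN u : compl_norm (- u) = compl_norm u.
Proof.
move: u; apply: quoP => s; rewrite -clsN compl_normE; apply/cvg_lim => //=.
by under eq_fun do rewrite msnN; apply: compl_norm_cvg.
Qed.

Lemma compl_norm1 : compl_norm 1 = 1.
Proof. by rewrite -(rmorph1 to_compl) compl_norm_to_compl msn1. Qed.
Lemma compl_norm0 : compl_norm 0 = 0.
Proof. by rewrite -(rmorph0 to_compl) compl_norm_to_compl msn0. Qed.

Lemma compl_norm_ge0 u : 0 <= compl_norm u.
Proof.
move: u; apply: quoP => s; rewrite compl_normE; apply: limr_ge.
  exact: msn_cvg (svalP s).
by apply: nearW => n; apply: msn_ge0.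
Qed.

Lemma compl_normD u v : compl_norm (u + v) <= Num.max (compl_norm u) (compl_norm v).
Proof.
move: u v; apply: quoP => s; apply: quoP => t; rewrite -clsD.
apply/ler_addgt0Pr => e e0; set M := Num.max _ _.
have hs := @compl_norm_cvg s; have ht := @compl_norm_cvg t.
rewrite compl_normE; apply: limr_le.
  exact: msn_cvg (svalP (pa s t)).
have /cvgrPdist_lt/(_ e e0)[N _ hN] := hs.
have /cvgrPdist_lt/(_ e e0)[N' _ hN'] := ht.
exists (maxn N N') => // n /=; rewrite geq_max => /andP[h1 h2].
apply: le_trans (msnD z _ _) _; rewrite ge_max; apply/andP; split.
  have := hN n h1; rewrite /= distrC => /ltr_distlDr/ltW/le_trans; apply.
  by rewrite lerD2r /M le_max lexx.
have := hN' n h2; rewrite /= distrC => /ltr_distlDr/ltW/le_trans; apply.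
by rewrite lerD2r /M le_max lexx orbT.
Qed.

Lemma compl_normB u v : compl_norm (u - v) <= Num.max (compl_norm u) (compl_norm v).
Proof. by rewrite -(compl_normN v); apply: compl_normD. Qed.

Definition circ_subring : subring compl.
Proof.
apply: (@Subring compl (fun u => compl_norm u <= 1)).
- by rewrite compl_norm1.
- by move=> a b ha hb; rewrite (le_trans (compl_normB _ _)) // ge_max ha hb.
- move=> a b ha hb; rewrite compl_normM.
  by rewrite -[leRHS]mulr1 ler_pM // compl_norm_ge0.
Defined.

Definition circ : comPzRingType := sub_ring circ_subring.

(* The ideal of elements of norm less than one is prime, as the norm is
   multiplicative. *)
Definition circcirc : spec circ.
Proof.
apply: (@MkSpec circ (fun a => compl_norm (val a) < 1)).
- by rewrite rmorph0 compl_norm0 ltr01.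
- move=> a b ha hb.
  by rewrite rmorphD (le_lt_trans (compl_normD _ _)) // gt_max ha hb.
- move=> a b hb; rewrite rmorphM compl_normM.
  rewrite (le_lt_trans _ hb) // -[leRHS]mul1r ler_wpM2r ?compl_norm_ge0 //.
  exact: (subP a).
- by rewrite rmorph1 compl_norm1 ltxx.
- move=> a b; rewrite rmorphM compl_normM => h.
  apply: contrapT => /not_orP[/negP]; rewrite -leNgt => ha /negP; rewrite -leNgt => hb.
  by move: h; rewrite ltNge -[leLHS]mulr1 ler_pM.
Defined.

Definition tilde : comPzRingType := prime_quot circcirc.

Lemma circ_base_subproof (a : k) : circ_subring (to_compl (c a)).
Proof. by rewrite /= compl_norm_to_compl msn_le1. Qed.

Definition circ_base : {rmorphism k -> circ} :=
  @sub_lift _ circ_subring _ (to_compl \o c) circ_base_subproof.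
Definition tilde_base : {rmorphism k -> tilde} := to_quot _ \o circ_base.
End Seminorm.

Section IsometryMaps.
Variables (R : realType) (k : fieldType) (L L' : comPzRingType)
  (c : {rmorphism k -> L}) (c' : {rmorphism k -> L'})
  (z : mseminorm R c) (z' : mseminorm R c')
  (f : {rmorphism L -> L'}) (hf : forall a, z' (f a) = z a).

Lemma cauchy_map s : cauchy_seq z s -> cauchy_seq z' (f \o s).
Proof.
by move=> hs e /hs[N h]; exists N => m n hm hn /=; rewrite -rmorphB hf h.
Qed.

Definition cseq_map (s : cseq z) : compl_pre z' :=
  exist _ _ (cauchy_map (svalP s)).

Definition compl_map : {rmorphism compl z -> compl z'}.
Proof.
apply: (@quo_lift (compl_pre z) _ (fun s => @cls (compl_pre z') (cseq_map s))).
- move=> s t h; apply/clsP => e /h[N hN]; exists N => n /hN.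
  by rewrite /= -rmorphB hf.
- rewrite -cls1; congr (cls _); apply: sig_inj; apply/funext => n /=.
  by rewrite rmorph1.
- move=> s t; rewrite -clsD; congr (cls _); apply: sig_inj; apply/funext => n /=.
  by rewrite rmorphD.
- move=> s t; rewrite -clsM; congr (cls _); apply: sig_inj; apply/funext => n /=.
  by rewrite rmorphM.
Defined.

Lemma compl_map_cls (s : compl_pre z) : compl_map (cls s) = cls (cseq_map s).
Proof. exact: quo_liftE. Qed.

Lemma compl_map_to_compl a : compl_map (to_compl z a) = to_compl z' (f a).
Proof. by rewrite compl_map_cls; congr (cls _); apply: sig_inj. Qed.

Lemma compl_map_norm u : compl_norm (compl_map u) = compl_norm u.
Proof.
move: u; apply: quoP => s; rewrite compl_map_cls !compl_normE /=.
by under eq_fun do rewrite hf.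
Qed.

Lemma circ_map_subproof (u : circ z) :
  circ_subring z' (compl_map (sub_val (circ_subring z) u)).
Proof. by rewrite /= compl_map_norm; apply: (subP u). Qed.

Definition circ_map : {rmorphism circ z -> circ z'} :=
  @sub_lift _ (circ_subring z') _ (compl_map \o sub_val (circ_subring z))
    circ_map_subproof.

Lemma circ_map_circcirc u : circcirc z u -> circcirc z' (circ_map u).
Proof. by rewrite /= compl_map_norm. Qed.

Definition tilde_map : {rmorphism tilde z -> tilde z'} :=
  quot_map circ_map_circcirc.
End IsometryMaps.

(* The points of the Berkovich space of Spec L (k being trivially valued) are
   the seminorms [mseminorm R c]. The completed residue field of such a point
   is the completion of the local ring at the kernel of the seminorm; the
   completion being separated, this is also the completion of the residue
   field of that local ring. *)
Section CompletedResidueField.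
Variables (R : realType) (k : fieldType) (L : comPzRingType)
  (c : {rmorphism k -> L}) (z : mseminorm R c).

Definition msn_ker : spec L.
Proof.
apply: (@MkSpec L (fun a => z a = 0)).
- exact: msn0.
- move=> a b ha hb; apply/eqP; rewrite eq_le msn_ge0 andbT.
  by rewrite (le_trans (msnD z _ _)) // ha hb maxxx.
- by move=> a b hb; rewrite msnM hb mulr0.
- by rewrite msn1; apply/eqP; rewrite oner_eq0.
- by move=> a b /eqP; rewrite msnM mulf_eq0 => /orP[] /eqP; [left|right].
Defined.

(* |a / s| = |a| / |s| *)
Definition loc_norm (x : loc msn_ker) : R :=
  z (rep x : loc_pre _).1 / z (sval (rep x : loc_pre _).2).

Lemma loc_norm_frac a s (hs : ~ msn_ker s) : loc_norm (frac a hs) = z a / z s.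
Proof.
rewrite /loc_norm; have [u /eqP hu /(congr1 z)] := rep_cls ((a, exist _ s hs) : loc_pre msn_ker).
rewrite !msnM /= => /(mulfI hu) e.
have /eqP h1 := svalP (rep (frac a hs) : loc_pre _).2; have /eqP h2 := hs.
by apply/eqP; rewrite eqr_div //; apply/eqP; rewrite -e.
Qed.

Definition loc_base : {rmorphism k -> loc msn_ker} := to_loc msn_ker \o c.

Definition loc_msn : mseminorm R loc_base.
Proof.
apply: (@MSeminorm _ _ _ loc_base loc_norm).
- by move=> x; rewrite divr_ge0 // msn_ge0.
- by rewrite -(rmorph0 (to_loc msn_ker)) loc_norm_frac msn0 mul0r.
- move=> x y; have [a [s [hs ->]]] := fracP x; have [b [t [ht ->]]] := fracP y.
  have -> : frac a hs * frac b ht = frac (a * b) (specNM hs ht).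
    by rewrite -clsM; apply/clsP; exists 1; [exact: spec1|rewrite /=; ring].
  by rewrite !loc_norm_frac !msnM invfM mulrACA.
- move=> x y; have [a [s [hs ->]]] := fracP x; have [b [t [ht ->]]] := fracP y.
  have -> : frac a hs + frac b ht = frac (a * t + b * s) (specNM hs ht).
    by rewrite -clsD; apply/clsP; exists 1; [exact: spec1|rewrite /=; ring].
  have s0 : 0 < z s by rewrite lt_def msn_ge0 andbT; apply/eqP.
  have t0 : 0 < z t by rewrite lt_def msn_ge0 andbT; apply/eqP.
  rewrite !loc_norm_frac msnM ler_pdivrMr ?mulr_gt0 //.
  rewrite (le_trans (msnD z _ _)) // !msnM maxr_pMl ?mulr_ge0 ?msn_ge0 //.
  have -> : z a / z s * (z s * z t) = z a * z t by field; rewrite gt_eqF.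
  have -> // : z b / z t * (z s * z t) = z b * z s by field; rewrite gt_eqF.
- move=> a a0; rewrite /loc_base /= loc_norm_frac msn1 divr1.
  exact: msn_triv.
Defined.
End CompletedResidueField.

(* The points of X^an over the generic point of X. *)
Record Xval (R : realType) (k : fieldType) (X : variety k) := MkXval {
  xnorm :> mseminorm R (base_ff X);
  xnorm_eq0 : forall f, xnorm f = 0 -> f = 0 }.

(* H(x), its ring of integers and its residue field. *)
Notation HH x := (compl (xnorm x)).
Notation HHcirc x := (circ (xnorm x)).
Notation HHtilde x := (tilde (xnorm x)).

Section Center.
Variables (R : realType) (k : fieldType) (X : variety k) (x : Xval R X).

(* The canonical morphism Spec H(x) -> X: it maps the point of Spec H(x) to the
   generic point, and on sections it is O_X(V) -> K(X) -> H(x). *)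
Definition canonical_pt (j : smor (Spec (HH x)) X) : Prop :=
  (forall q : Spec (HH x), closure [set j q] = [set: X]) /\
  forall (V : opens X) (U : opens (Spec (HH x))) (hV : V !=set0)
    (h : U `<=` j @^-1` V) (s : sec X V),
    sharp h s = spec_cst U (to_compl (xnorm x) (@germ X (dgen X) V hV s)).

(* [h] extends Spec H(x) -> X to the ring of integers, over k. *)
Definition extends_pt (h : smor (Spec (HHcirc x)) X) : Prop :=
  canonical_pt (scomp h (spec_map (sub_val (circ_subring (xnorm x))))) /\
  smor_eq (scomp (vstr X) h) (spec_map (circ_base (xnorm x))).

Definition closed_pt : Spec (HHcirc x) := circcirc (xnorm x).

Definition is_center (p : X) : Prop := exists2 h, extends_pt h & h closed_pt = p.

(* The map from the residue field at the center to the residue field of H(x)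
   induced by [h]: the value at the center of a section s of O_X whose image
   under [h] is (near the closed point) the element a of the ring of integers
   is mapped to the class of a. *)
Definition canonical_residue (h : smor (Spec (HHcirc x)) X)
    (iota : {rmorphism residue_field (h closed_pt) -> HHtilde x}) : Prop :=
  forall (V : opens X) (U : opens (Spec (HHcirc x))) (hV : oset V (h closed_pt))
    (hU : U `<=` h @^-1` V) (s : sec X V) (a : HHcirc x),
    oset U closed_pt -> sharp hU s = spec_cst U a ->
    iota (germ_residue hV s) = to_quot _ a.
End Center.

(* The elements f : Y -> X of B(X, x), together with the valuation of K(Y) which
   corresponds to x and its extension h, which defines the center. The condition
   that f is the identity over V is read up to isomorphism. *)
Definition in_B (R : realType) (k : fieldType) (X : variety k) (x : Xval R X)
    (Y : variety k) (f : smor Y X) (x' : Xval R Y)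
    (h : smor (Spec (HHcirc x')) Y) : Prop :=
  [/\ over_base f, proper f, birational f,
    exists2 V : opens X, V !=set0 & iso_on f (rpre f V) V &
    (exists hf : dominant f, forall g, x' (ff_map hf g) = x g) /\
    extends_pt h].

Definition Xstar (R : realType) (k : fieldType) (X : variety k) (x : Xval R X) : Prop :=
  exists (Y : variety k) (f : smor Y X) (x' : Xval R Y)
    (h : smor (Spec (HHcirc x')) Y), in_B x f h /\
    exists2 iota : {rmorphism residue_field (h (closed_pt x')) -> HHtilde x'},
      canonical_residue iota & bijective iota.

Record gaction (G : finGroupType) (k : fieldType) (X : variety k) := GAction {
  act :> G -> smor X X;
  act_over : forall g, over_base (act g);
  act1 : smor_eq (act 1%g) (sid X);
  actM : forall g h, smor_eq (act (g * h)%g) (scomp (act g) (act h)) }.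

Definition inv_subring (I : Type) (A : comPzRingType) (f : I -> {rmorphism A -> A}) :
  subring A.
Proof.
apply: (@Subring A (fun a => forall i, f i a = a)).
- by move=> i; rewrite rmorph1.
- by move=> a b ha hb i; rewrite rmorphB ha hb.
- by move=> a b ha hb i; rewrite rmorphM ha hb.
Defined.

Section Action.
Variables (G : finGroupType) (k : fieldType) (X : variety k) (ac : gaction G X).

Lemma act_dominant (g : G) : dominant (ac g).
Proof.
move=> V [p Vp]; exists (ac g^-1%g p).
have e1 : ac (g * g^-1)%g p = ac g (ac g^-1%g p) := (actM ac g g^-1%g).1 p.
have e2 : ac 1%g p = p := (act1 ac).1 p.
by rewrite /= -e1 mulgV e2.
Qed.

Definition act_ff (g : G) : {rmorphism function_field X -> function_field X} :=
  ff_map (act_dominant g).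

Definition G_invariant (R : realType) (x : Xval R X) : Prop :=
  forall g f, x (act_ff g f) = x f.

Definition act_tilde (R : realType) (x : Xval R X) (hx : G_invariant x) (g : G) :
  {rmorphism HHtilde x -> HHtilde x} := tilde_map (hx g).

Definition stable (U : opens X) : Prop := forall g, U `<=` ac g @^-1` U.

Section Quotient.
Variables (U : opens X) (hU : stable U).

Definition act_sec (g : G) : {rmorphism sec X U -> sec X U} := sharp (hU g).

(* A^G, where U = Spec A *)
Definition inv_sec : comPzRingType := sub_ring (inv_subring act_sec).

Lemma inv_sec_base_subproof (a : k) : inv_subring act_sec (base_sec U a).
Proof.
move=> g.
pose T := opensT (Spec k); pose s : sec (Spec k) T := spec_cst (opensT (SpecR k)) a.
pose hT := @pre_opensT X _ (vstr X) U.
have k1 : U `<=` rpre (vstr X) T by [].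
have k2 : U `<=` scomp (vstr X) (ac g) @^-1` T by [].
have e : sharp k2 s = sharp hT s := (act_over ac g).2 T U k2 hT s.
have e1 : res k1 (sharp (rpre_sub : rpre (vstr X) T `<=` _) s) = sharp hT s.
  by rewrite (sharp_res (@opens_refl _ T) k1 rpre_sub hT) res_id.
pose k3 : U `<=` ac g @^-1` rpre (vstr X) T := k2.
have e2 := sharp_res k1 (@opens_refl _ U) k3 (hU g)
  (sharp (rpre_sub : rpre (vstr X) T `<=` _) s).
rewrite res_id e1 in e2.
exact: etrans (esym e2) e.
Qed.

Definition inv_base : {rmorphism k -> inv_sec} :=
  @sub_lift _ (inv_subring act_sec) _ (base_sec U) inv_sec_base_subproof.

Section Point.
Variables (R : realType) (x : Xval R X) (Une : U !=set0).

(* The restriction of |.|_x to A^G, that is the image of x in the Berkovich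
   space of U/G = Spec A^G. *)
Definition inv_to_ff : {rmorphism inv_sec -> function_field X} :=
  to_germs (Une : dgen X U) \o sub_val (inv_subring act_sec).

Lemma inv_to_ff_base (a : k) : inv_to_ff (inv_base a) = base_ff X a.
Proof.
pose T := opensT (Spec k); pose s : sec (Spec k) T := spec_cst (opensT (SpecR k)) a.
have k1 : U `<=` opensT X by [].
have e := sharp_res (@opens_refl _ T) k1 (@pre_opensT _ _ (vstr X) (opensT X))
  (@pre_opensT _ _ (vstr X) U) s.
rewrite res_id in e.
have e1 := germ_res (Une : dgen X U) (dirT (dgen X)) k1
  (sharp (@pre_opensT _ _ (vstr X) (opensT X)) s).
rewrite e in e1; exact: e1.
Qed.

Definition phi_an : mseminorm R inv_base.
Proof.
apply: (@MSeminorm _ _ _ inv_base (fun a => x (inv_to_ff a))).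
- by move=> a; apply: msn_ge0.
- by rewrite rmorph0 msn0.
- by move=> a b; rewrite rmorphM msnM.
- by move=> a b; rewrite rmorphD; apply: msnD.
- by move=> a a0; rewrite inv_to_ff_base; apply: msn_triv.
Defined.
End Point.
End Quotient.

Lemma act_ff_base (g : G) (a : k) : act_ff g (base_ff X a) = base_ff X a.
Proof.
have hT : stable (opensT X) by [].
have h := inv_sec_base_subproof hT a g.
have e := @germ_mapE _ _ (ac g) (dgen X) (dgen X) (act_dominant g) _ _
  (dirT (dgen X)) (dirT (dgen X)) (hT g) (base_sec (opensT X) a).
by rewrite -[sharp _ _]/(act_sec hT g _) h in e; exact: e.
Qed.

Section Tilde.
Variables (R : realType) (x : Xval R X) (hx : G_invariant x).

Definition inv_tilde : comPzRingType := sub_ring (inv_subring (act_tilde hx)).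

Lemma inv_tilde_base_subproof (a : k) :
  inv_subring (act_tilde hx) (tilde_base (xnorm x) a).
Proof.
move=> g; rewrite /act_tilde /tilde_map /tilde_base.
apply: etrans (quot_mapE _ _) _; congr (to_quot _ _); apply: val_inj.
have e := compl_map_to_compl (hx g) (base_ff X a).
by rewrite act_ff_base in e; exact: e.
Qed.

Definition inv_tilde_base : {rmorphism k -> inv_tilde} :=
  @sub_lift _ (inv_subring (act_tilde hx)) _ (tilde_base (xnorm x))
    inv_tilde_base_subproof.
End Tilde.
End Action.

Definition k_isomorphic (k : fieldType) (A B : comPzRingType)
    (cA : {rmorphism k -> A}) (cB : {rmorphism k -> B}) : Prop :=
  exists2 psi : {rmorphism A -> B}, bijective psi & forall a, psi (cA a) = cB a.

(* Main.v *)
Require Import Defs.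
From mathcomp Require Import all_boot all_order all_algebra fingroup.
From mathcomp Require Import boolp classical_sets reals topology.
From mathcomp Require Import normedtype sequences ring.
Import Order.TTheory GRing.Theory Num.Theory.

(** Write K for the function field of X and A for the ring of sections over U.
    Since every element of H(x) is a limit of elements of K, every residue class
    is the class of some f in K with |f| <= 1 ([residue_surj]); likewise over
    the quotient, with Frac(A^G) in the place of K. So the theorem compares the
    residue fields of the valuation of K and of its restriction to Frac(A^G).

    The inclusion of A^G in K extends to an isometry of Frac(A^G) into the
    G-invariant elements of K ([quotient_function_field]), and an isometry
    induces an injection of residue fields ([tilde_map_inj]). It remains to see
    that every invariant class comes from Frac(A^G). Lift it to some f in K.
    The order of G is a nonzero constant of k, hence has norm 1, so the average
    of f over G still has norm at most 1, and its class is the average of the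
    translates of the class of f, that is, the same class ([average_residue]).
    The average is an invariant element of K, so it is a quotient of elements
    of A^G: multiply the denominator of a fraction by its conjugates
    ([average_fraction]).

    The geometric input is that K consists of fractions of sections over the
    affine open set U ([function_field_fraction]) and that an element of K of
    nonzero norm is invertible ([function_field_unit]). Both are proved on a
    spectrum, where the prime ideal at which the valuation vanishes plays the
    role of the generic point. *)

Set Implicit Arguments.
Unset Strict Implicit.
Unset Printing Implicit Defensive.
Local Open Scope classical_set_scope.
Local Open Scope ring_scope.

(** * Units and localization *)

Lemma rmorphism_inverse (A B : pzRingType) (f : {rmorphism A -> B}) :
  injective f -> (forall b, exists a, f a = b) ->
  exists2 g : {rmorphism B -> A}, cancel f g & cancel g f.
Proof.
move=> finj fsurj.
pose g b := sval (cid (fsurj b)).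
have gK : cancel g f by move=> b; rewrite /g; case: cid.
have fK : cancel f g by move=> a; apply: finj; rewrite gK.
have g1 : g 1 = 1 by apply: finj; rewrite gK rmorph1.
have gD a b : g (a + b) = g a + g b by apply: finj; rewrite rmorphD !gK.
have gM a b : g (a * b) = g a * g b by apply: finj; rewrite rmorphM !gK.
by exists (mk_rmorphism g1 gD gM).
Qed.

Lemma is_unitM (A : comPzRingType) (a b : A) :
  is_unit a -> is_unit b -> is_unit (a * b).
Proof. by move=> [c ac] [d bd]; exists (c * d); rewrite mulrACA ac bd mulr1. Qed.

Lemma is_unit_mull (A : comPzRingType) (a b : A) : is_unit (a * b) -> is_unit a.
Proof. by move=> [c abc]; exists (b * c); rewrite mulrA. Qed.

Lemma is_unit_rmorph (A B : comPzRingType) (f : {rmorphism A -> B}) (a : A) :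
  is_unit a -> is_unit (f a).
Proof. by move=> [c ac]; exists (f c); rewrite -rmorphM ac rmorph1. Qed.

Lemma is_unit_mulI (A : comPzRingType) (a b c : A) :
  is_unit c -> a * c = b * c -> a = b.
Proof. by move=> [d cd] /(congr1 ( *%R^~ d)); rewrite -!mulrA cd !mulr1. Qed.

Section LocLift.
Variables (A B : comPzRingType) (p : spec A) (f : {rmorphism A -> B}).
Hypothesis f_unit : forall s, ~ p s -> is_unit (f s).

(** The universal property of the localization at a prime ideal. The equation
    characterizes F, since f s is a unit, without naming its inverse. *)
Lemma loc_lift_exists :
  exists F : {rmorphism loc p -> B},
    forall a s (hs : ~ p s), F (Defs.frac a hs) * f s = f a.
Proof.
pose inv (s : {s | ~ p s}) : B := sval (cid (f_unit (svalP s))).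
have invP s : f (sval s) * inv s = 1 by rewrite /inv; case: cid.
pose F0 (x : loc_pre p) : B := f x.1 * inv x.2.
have F0P x : F0 x * f (sval x.2) = f x.1.
  by rewrite /F0 -mulrA [inv _ * _]mulrC invP mulr1.
have uM s t : ~ p s -> ~ p t -> is_unit (f s * f t).
  by move=> hs ht; apply: is_unitM; apply: f_unit.
have Fe x y : peq x y -> F0 x = F0 y.
  move=> [u hu e].
  have v : is_unit (f u * (f (sval x.2) * f (sval y.2))).
    by apply: is_unitM; [exact: f_unit | exact: uM (svalP x.2) (svalP y.2)].
  apply: (is_unit_mulI v).
  transitivity (f (u * (x.1 * sval y.2))).
    by rewrite !rmorphM -(F0P x); ring.
  by rewrite e !rmorphM -(F0P y); ring.
have F1 : F0 (po (loc_pre p)) = 1.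
  by have := F0P (po (loc_pre p)); rewrite /= rmorph1 mulr1.
have FD x y : F0 (pa x y) = F0 x + F0 y.
  apply: (is_unit_mulI (uM _ _ (svalP x.2) (svalP y.2))).
  have := F0P (pa x y); rewrite /= rmorphD !rmorphM => ->.
  by rewrite -(F0P x) -(F0P y); ring.
have FM x y : F0 (pm x y) = F0 x * F0 y.
  apply: (is_unit_mulI (uM _ _ (svalP x.2) (svalP y.2))).
  have := F0P (pm x y); rewrite /= !rmorphM => ->.
  by rewrite -(F0P x) -(F0P y); ring.
exists (@quo_lift (loc_pre p) _ F0 Fe F1 FD FM) => a s hs.
by rewrite quo_liftE; exact: (F0P (a, exist _ s hs)).
Qed.
End LocLift.

(** * Residue fields of completions *)

Section Residues.
Variables (R : realType) (k : fieldType) (L : comPzRingType)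
  (c : {rmorphism k -> L}) (z : mseminorm R c).

Definition val_subring : subring L.
Proof.
apply: (@Subring L (fun a => z a <= 1)).
- by rewrite msn1.
- by move=> a b ha hb; rewrite (le_trans (msnB z _ _)) // ge_max ha hb.
- by move=> a b ha hb; rewrite msnM mulr_ile1 ?msn_ge0.
Defined.

Lemma circ_of_val_subproof (a : sub_ring val_subring) :
  circ_subring z (to_compl z (val a)).
Proof. by rewrite /= compl_norm_to_compl; exact: (subP a). Qed.

(** The reduction map of the valuation ring of L itself. With [residue_surj] it
    allows one to compute in the residue field of the completion without
    Cauchy sequences. *)
Definition residue : {rmorphism sub_ring val_subring -> tilde z} :=
  to_quot (circcirc z) \o
  @sub_lift _ (circ_subring z) _ (to_compl z \o sub_val val_subring)
    circ_of_val_subproof.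

Lemma compl_dense (w : compl z) (e : R) :
  0 < e -> exists a, compl_norm (w - to_compl z a) <= e.
Proof.
move=> e0; move: w; apply: quoP => s.
have [N hN] := svalP s _ e0; exists (sval s N).
rewrite -[to_compl z _]/(@cls (compl_pre z) (exist _ _ (cauchy_cst z (sval s N)))).
rewrite -clsN -clsD compl_normE; apply: limr_le.
  exact: msn_cvg (svalP (pa s (pn (exist _ _ (cauchy_cst z (sval s N)) : compl_pre z)))).
by exists N => // n hn; apply/ltW/hN.
Qed.

Lemma residue_surj (u : tilde z) : exists a, residue a = u.
Proof.
have [w ->] := to_quot_surj u.
(* Any bound below 1 would do: a strict inequality is lost in the limit. *)
have h0 : 0 < 2^-1 :> R by rewrite invr_gt0 ltr0n.
have h1 : 2^-1 < 1 :> R by rewrite invf_lt1 ?ltr1n ?ltr0n.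
have [a ha] := compl_dense (val w) h0.
have a1 : val_subring a.
  rewrite /= -(compl_norm_to_compl z a) -(subKr (val w) (to_compl z a)).
  apply: le_trans (compl_normB _ _) _.
  by rewrite ge_max (subP w) (le_trans ha) // ltW.
exists (mksub a1); apply/to_quotP.
change (compl_norm (to_compl z a - val w) < 1).
by rewrite -opprB compl_normN; exact: le_lt_trans ha h1.
Qed.

Lemma residue_base (a : k) (h : val_subring (c a)) :
  residue (mksub h) = tilde_base z a.
Proof. by congr (to_quot _ _); apply: val_inj. Qed.
End Residues.

Section ResidueMaps.
Variables (R : realType) (k : fieldType) (L L' : comPzRingType)
  (c : {rmorphism k -> L}) (c' : {rmorphism k -> L'})
  (z : mseminorm R c) (z' : mseminorm R c')
  (f : {rmorphism L -> L'}) (hf : forall a, z' (f a) = z a).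

Lemma tilde_mapE (a : circ z) :
  tilde_map hf (to_quot _ a) = to_quot _ (circ_map hf a).
Proof. exact: quot_mapE. Qed.

(** An element of norm less than 1 is already so before the isometry. *)
Lemma tilde_map_inj : injective (tilde_map hf).
Proof.
move=> u v; have [a ->] := to_quot_surj u; have [b ->] := to_quot_surj v.
move=> e; have {}e := etrans (esym (tilde_mapE a)) (etrans e (tilde_mapE b)).
apply/to_quotP; move/to_quotP : e.
rewrite -(rmorphB (circ_map hf)).
change (compl_norm (compl_map hf (val (a - b))) < 1 -> compl_norm (val (a - b)) < 1).
by rewrite compl_map_norm.
Qed.

Lemma val_map_subproof (a : sub_ring (val_subring z)) :
  val_subring z' (f (val a)).
Proof. by rewrite /= hf; exact: (subP a). Qed.

Lemma tilde_map_residue (a : sub_ring (val_subring z)) :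
  tilde_map hf (residue z a) = residue z' (mksub (val_map_subproof a)).
Proof.
apply: etrans (tilde_mapE _) _; congr (to_quot _ _); apply: val_inj.
exact: compl_map_to_compl.
Qed.

Lemma tilde_map_base (fc : forall a, f (c a) = c' a) (a : k) :
  tilde_map hf (tilde_base z a) = tilde_base z' a.
Proof.
apply: etrans (tilde_mapE _) _; congr (to_quot _ _); apply: val_inj.
by apply: etrans (compl_map_to_compl hf (c a)) _; rewrite fc.
Qed.

Lemma tilde_map_fixed (g : {rmorphism L' -> L'}) (hg : forall b, z' (g b) = z' b)
    (gf : forall a, g (f a) = f a) (v : tilde z) :
  tilde_map hg (tilde_map hf v) = tilde_map hf v.
Proof.
have [l <-] := residue_surj v; rewrite tilde_map_residue.
apply: etrans (quot_mapE _ _) _; congr (to_quot _ _); apply: val_inj.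
by apply: etrans (compl_map_to_compl hg _) _; rewrite /= gf.
Qed.
End ResidueMaps.

(** * The function field from an affine open set *)

Section AffineFunctionField.
Variables (k : fieldType) (X : variety k) (A : comPzRingType)
  (U : opens X) (Une : U !=set0) (j : rmor (SpecR A) X)
  (jU : iso_on j (opensT (SpecR A)) U).

Let jinj p q : j p = j q -> p = q.
Proof. by case: jU => _ h _ _; apply: h. Qed.

Let jin p : oset U (j p).
Proof. by case: jU => <- _ _ _; exists p. Qed.

(** The open set j(W) of X. Every nonempty open set of X contains one of these,
    and over it the sections of X are those of the spectrum over W
    ([sharp_spec_image]); hence K(X) is the ring of germs of the spectrum. *)
Definition spec_image (W : opens (SpecR A)) : opens X.
Proof.
apply: (@Opens X (j @` W)).
by case: jU => _ _ h _; apply: h.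
Defined.

Lemma spec_image_sub W : spec_image W `<=` U.
Proof. by move=> _ [p _ <-]. Qed.

Lemma rpre_spec_image (W : opens (SpecR A)) :
  opensI (opensT (SpecR A)) (rpre j (spec_image W)) `<=` W.
Proof. by move=> p [_ [q Wq /jinj <-]]. Qed.

Lemma spec_image_rpre (W : opens (SpecR A)) :
  W `<=` opensI (opensT (SpecR A)) (rpre j (spec_image W)).
Proof. by move=> p Wp; split=> //; exists p. Qed.

Lemma rpre_nonempty (V : opens X) : V !=set0 -> rpre j V !=set0.
Proof.
move=> Vne; have [q [Uq Vq]] := (v_integral X).1.2 _ _ Une Vne.
by case: jU => ju _ _ _; move: Uq; rewrite -ju => -[p _ jp]; exists p; rewrite /= jp.
Qed.

(** The nonempty open sets of the spectrum. They are closed under intersection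
    because X is irreducible and j is injective with open image. *)
Definition spec_dgen : direction (SpecR A).
Proof.
apply: (@Direction (SpecR A) (fun W => W !=set0)).
- by have [p hp] := rpre_nonempty (dirT (dgen X)); exists p.
- move=> W W' [p Wp] [q Wq].
  have h : spec_image W !=set0 by exists (j p), p.
  have h' : spec_image W' !=set0 by exists (j q), q.
  have [_ [[r Wr <-] [r' Wr' /jinj e]]] := (v_integral X).1.2 _ _ h h'.
  by exists r; split=> //; rewrite -e.
Defined.

Definition spec_germ : {rmorphism function_field X -> germs spec_dgen} :=
  @germ_map (SpecR A) X j spec_dgen (dgen X) rpre_nonempty.

Lemma spec_germE (V : opens X) (W : opens (SpecR A)) (hV : V !=set0)
    (hW : W !=set0) (h : W `<=` j @^-1` V) s :
  spec_germ (@germ _ (dgen X) V hV s) = @germ _ spec_dgen W hW (sharp h s).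
Proof. exact: germ_mapE. Qed.

(** The isomorphism condition speaks of the full inverse image of j(W), which is W
    by injectivity of j; restriction along these two inclusions transports it. *)
Lemma sharp_spec_image (W : opens (SpecR A)) (h : W `<=` j @^-1` spec_image W) :
  injective (sharp h) /\ forall t, exists s, sharp h s = t.
Proof.
have := jU; case=> _ _ _ /(_ (spec_image W) (@spec_image_sub W)) [g gK Kg].
set h1 := (X in sharp X) in gK Kg.
have e s : sharp h s = res (@spec_image_rpre W) (sharp h1 s).
  by rewrite (sharp_res (@opens_refl _ _) _ _ h) res_id.
have e1 s : sharp h1 s = res (@rpre_spec_image W) (sharp h s).
  by rewrite (sharp_res (@opens_refl _ _) _ _ h1) res_id.
split=> [s s' ss'|t]; first by apply: (can_inj gK); rewrite !e1 ss'.
exists (g (res (@rpre_spec_image W) t)).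
by rewrite e Kg (res_comp _ _ (@opens_refl _ W)) res_id.
Qed.

Lemma spec_germ_inj : injective spec_germ.
Proof.
move=> x y; have [V [hV [s ->]]] := germE x; have [V' [hV' [s' ->]]] := germE y.
rewrite (spec_germE hV (rpre_nonempty hV) rpre_sub).
rewrite (spec_germE hV' (rpre_nonempty hV') rpre_sub).
move=> /germP [W [hW [h1 [h2 e]]]].
have k1 : spec_image W `<=` V by move=> _ [p /h1 Vp <-].
have k2 : spec_image W `<=` V' by move=> _ [p /h2 Vp <-].
have hW' : dgen X (spec_image W) by case: hW => p Wp; exists (j p), p.
apply/germP; exists (spec_image W), hW', k1, k2.
have h : W `<=` j @^-1` spec_image W by move=> p Wp; exists p.
apply: (sharp_spec_image h).1.
by rewrite -(sharp_res k1 h1 rpre_sub) -(sharp_res k2 h2 rpre_sub).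
Qed.

Lemma spec_germ_surj y : exists x, spec_germ x = y.
Proof.
have [W [hW [t ->]]] := germE y.
have h : W `<=` j @^-1` spec_image W by move=> p Wp; exists p.
have hW' : spec_image W !=set0 by case: hW => p Wp; exists (j p), p.
have [s <-] := (sharp_spec_image h).2 t.
by exists (@germ _ (dgen X) _ hW' s); rewrite (spec_germE _ hW h).
Qed.

Definition spec_const : {rmorphism A -> germs spec_dgen} :=
  to_germs (dirT spec_dgen) \o spec_cst (opensT (SpecR A)).

Lemma spec_const_germ (W : opens (SpecR A)) (hW : W !=set0) (a : A) :
  spec_const a = @germ _ spec_dgen W hW (spec_cst W a).
Proof.
have k1 : W `<=` opensT (SpecR A) by [].
apply: etrans (esym (germ_res (hW : spec_dgen W) (dirT spec_dgen) k1 _)) _.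
by congr (germ _ _); apply: spec_sec_ext.
Qed.

(** Elements of A come from sections over U, so fractions over A become fractions
    of sections over U. The section is found over the image of the whole
    spectrum, which equals U only propositionally; hence the restriction. *)
Lemma spec_const_sec (a : A) :
  exists s : sec X U, spec_germ (@germ _ (dgen X) U Une s) = spec_const a.
Proof.
have UV : U `<=` spec_image (opensT (SpecR A)).
  by case: jU => <- _ _ _ _ [p _ <-]; exists p.
have h : opensT (SpecR A) `<=` j @^-1` spec_image (opensT (SpecR A)).
  by move=> p _; exists p.
have [s sE] := (sharp_spec_image h).2 (spec_cst _ a).
exists (res UV s); rewrite (spec_germE _ (dirT spec_dgen) (fun p _ => jin p)).
by rewrite -(sharp_res UV (@opens_refl _ _) h) res_id sE.
Qed.

(** If D(a) is nonempty, then the section 1 / a over it inverts a. *)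
Lemma spec_const_unit (a : A) (r : SpecR A) : ~ r a -> is_unit (spec_const a).
Proof.
move=> ra.
have oD : open [set q : SpecR A | ~ q a] by rewrite zopenE => q hq; exists a.
pose W : opens (SpecR A) := Opens oD.
have hW : W !=set0 by exists r.
have hn (q : spec A) : oset W q -> ~ q a by [].
exists (@germ _ spec_dgen W hW (frac_sec 1 hn : sec (SpecR A) W)).
rewrite (spec_const_germ hW) -germM -(germ1 (hW : spec_dgen W)).
congr (germ _ _); apply: spec_sec_ext => q hq.
have [-> _ _ ->] := sval_at_rmorph hq.
change (to_loc q a * Defs.frac 1 (hn q hq) = 1).
by rewrite mulrC frac_mul rmorph1.
Qed.

(** Sections of the structure sheaf are fractions locally, and a germ only sees
    one small open set. The prime r, at which the fraction is defined, is what
    makes the denominator invertible by [spec_const_unit]. *)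
Lemma spec_germ_fraction (y : germs spec_dgen) :
  exists a b (r : SpecR A), ~ r b /\ y * spec_const b = spec_const a.
Proof.
have [W [[p Wp] [t ->]]] := germE y.
have [W' [a [b [W'p W'W h]]]] := spec_secP (t : spec_sec W) Wp.
exists a, b, p; split; first by have [] := h p Wp W'p.
have hW' : W' !=set0 by exists p.
rewrite !(spec_const_germ hW') -(germ_res (hW' : spec_dgen W') _ W'W) -germM.
congr (germ _ _); apply: spec_sec_ext => q hq.
have [_ _ _ ->] := sval_at_rmorph hq.
by have [_] := h q (W'W q hq) hq.
Qed.
End AffineFunctionField.

Lemma function_field_fraction (k : fieldType) (X : variety k) (U : opens X)
    (Une : U !=set0) (Uaff : affine_open U) (f : function_field X) :
  exists a b : sec X U, is_unit (@germ _ (dgen X) U Une b) /\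
    f * @germ _ (dgen X) U Une b = @germ _ (dgen X) U Une a.
Proof.
have [A [j jU]] := Uaff.
have [a [b [r [rb e]]]] := spec_germ_fraction (spec_germ Une jU f).
have [s sE] := spec_const_sec Une jU a; have [t tE] := spec_const_sec Une jU b.
exists s, t; split; last by apply: (@spec_germ_inj _ _ _ _ Une _ jU); rewrite rmorphM sE tE.
have [v] := spec_const_unit Une jU rb; have [w <-] := spec_germ_surj v.
rewrite -tE -rmorphM => e'; exists w; apply: (@spec_germ_inj _ _ _ _ Une _ jU).
by rewrite e' rmorph1.
Qed.

Lemma msn_unit (R : realType) (k : fieldType) (L : comPzRingType)
    (c : {rmorphism k -> L}) (z : mseminorm R c) (a : L) :
  is_unit a -> z a <> 0.
Proof.
move=> [b ab] a0; have := msn1 z; rewrite -ab msnM a0 mul0r => /esym/eqP.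
by rewrite oner_eq0.
Qed.

(** The elements a of A with x a = 0 form a prime ideal q. If f = a / b has
    nonzero norm, then a is not in q, so D(a) contains q and a is invertible
    near it. Thus the valuation provides the point of D(a) that is usually
    obtained from the fact that a is not nilpotent. *)
Lemma function_field_unit (R : realType) (k : fieldType) (X : variety k)
    (x : Xval R X) (f : function_field X) : x f <> 0 -> is_unit f.
Proof.
move=> f0; have [p] := (v_integral X).1.1.
have [U Up [A [j jU]]] := s_affine p.
have Une : U !=set0 by exists p.
have [J JK KJ] := rmorphism_inverse (@spec_germ_inj _ _ _ _ Une _ jU)
  (@spec_germ_surj _ _ _ _ Une _ jU).
pose q : SpecR A := comap (J \o spec_const Une jU) (msn_ker (xnorm x)).
have [a [b [r [rb e]]]] := spec_germ_fraction (spec_germ Une jU f).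
have bu := spec_const_unit Une jU rb.
have e' : f * J (spec_const Une jU b) = J (spec_const Une jU a).
  by rewrite -e rmorphM JK.
have qa : ~ q a.
  rewrite /q /= -e' msnM => /eqP; rewrite mulf_eq0 => /orP[]/eqP // .
  by apply: msn_unit; apply: is_unit_rmorph.
have := is_unit_rmorph J (spec_const_unit Une jU qa).
by rewrite -e' => /is_unit_mull.
Qed.

(** * Averages over the group *)

Lemma card_group_neq0 (k : fieldType) (G : finGroupType) :
  (forall q : nat, q \in [pchar k] -> coprime #|G| q) -> #|G|%:R != 0 :> k.
Proof.
move=> hG; apply/negP => G0.
have G1 : (0 < #|G|)%N by apply/card_gt0P; exists 1%g.
have [q qk] := natf0_pchar G1 G0; have /andP[qpr _] := qk.
have := hG q qk; rewrite coprime_sym prime_coprime // => /negP; apply.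
by rewrite (dvdn_pcharf qk) G0.
Qed.

Section InvariantFractions.
Variables (k : fieldType) (X : variety k) (G : finGroupType) (ac : gaction G X).

Section Sections.
Variables (U : opens X) (UG : stable ac U).

Lemma act_sec1 (s : sec X U) : act_sec UG 1%g s = s.
Proof.
have h : U `<=` sid X @^-1` U by [].
by apply: etrans ((act1 ac).2 U U (UG 1%g) h s) _; exact: res_id.
Qed.

(** The group acts on X from the left, hence on sections from the right. *)
Lemma act_secM (g h : G) (s : sec X U) :
  act_sec UG (g * h)%g s = act_sec UG h (act_sec UG g s).
Proof.
have gh : U `<=` scomp (ac g) (ac h) @^-1` U by move=> p /(UG h)/(UG g).
apply: etrans ((actM ac g h).2 U U (UG (g * h)%g) gh s) _.
change (sharp (gh : U `<=` ac h @^-1` rpre (ac g) U)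
  (sharp (rpre_sub : rpre (ac g) U `<=` ac g @^-1` U) s) =
  act_sec UG h (act_sec UG g s)).
have e1 := sharp_res (@opens_refl _ U) (UG g : U `<=` rpre (ac g) U)
  rpre_sub (UG g) s.
rewrite res_id in e1.
have e2 := sharp_res (UG g : U `<=` rpre (ac g) U) (@opens_refl _ U)
  (gh : U `<=` ac h @^-1` rpre (ac g) U) (UG h) (sharp rpre_sub s).
by rewrite res_id e1 in e2.
Qed.

Lemma act_ff_germ (Une : U !=set0) (g : G) (s : sec X U) :
  act_ff ac g (@germ _ (dgen X) U Une s) =
  @germ _ (dgen X) U Une (act_sec UG g s).
Proof. exact: germ_mapE. Qed.

Lemma act_sec_sum (h : G) (s : sec X U) :
  act_sec UG h (\sum_g act_sec UG g s) = \sum_g act_sec UG g s.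
Proof.
rewrite rmorph_sum [RHS](reindex_inj (mulIg h)) /=.
by apply: eq_bigr => g _; rewrite act_secM.
Qed.

Lemma act_sec_prod (h : G) (s : sec X U) :
  act_sec UG h (\prod_g act_sec UG g s) = \prod_g act_sec UG g s.
Proof.
rewrite rmorph_prod [RHS](reindex_inj (mulIg h)) /=.
by apply: eq_bigr => g _; rewrite act_secM.
Qed.
End Sections.

Definition average (f : function_field X) : function_field X :=
  base_ff X (#|G|%:R^-1) * \sum_g act_ff ac g f.

(** Multiplying numerator and denominator of f = a / b by the other conjugates
    of b gives f = a' / N with N invariant. Then the average of f is the
    average of a' divided by N, a quotient of invariant sections. Averaging the
    numerator as a section makes it invariant in A itself, not only in K. *)
Lemma average_fraction (U : opens X) (UG : stable ac U) (Une : U !=set0)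
    (Uaff : affine_open U) (f : function_field X) :
  exists a s : inv_sec UG, is_unit (inv_to_ff UG Une s) /\
    average f * inv_to_ff UG Une s = inv_to_ff UG Une a.
Proof.
pose ger := @to_germs _ (dgen X) U Une.
have gerE g t : act_ff ac g (ger t) = ger (act_sec UG g t) by exact: act_ff_germ.
have [a [b [bu fb]]] := function_field_fraction Une Uaff f.
have {}bu : is_unit (ger b) := bu; have {}fb : f * ger b = ger a := fb.
pose N := \prod_g act_sec UG g b.
pose a' := a * \prod_(g | g != 1%g) act_sec UG g b.
have fN : f * ger N = ger a'.
  by rewrite /N (bigD1 1%g) // act_sec1 !(rmorphM ger) mulrA fb.
have Nu : is_unit (ger N).
  rewrite rmorph_prod; apply: (big_ind (@is_unit _)).
  - by exists 1; rewrite mulr1.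
  - exact: is_unitM.
  - by move=> g _; rewrite -gerE; exact: is_unit_rmorph.
pose s : inv_sec UG := @mksub _ (inv_subring (act_sec UG)) N
  (fun g => act_sec_prod UG g b).
pose t : inv_sec UG := @mksub _ (inv_subring (act_sec UG))
  (\sum_g act_sec UG g a') (fun g => act_sec_sum UG g a').
exists (inv_base UG (#|G|%:R^-1) * t), s; split=> //.
rewrite rmorphM inv_to_ff_base /average -mulrA; congr (_ * _).
change ((\sum_g act_ff ac g f) * ger N = ger (\sum_g act_sec UG g a')).
rewrite rmorph_sum mulr_suml; apply: eq_bigr => g _.
by rewrite -gerE -fN rmorphM gerE act_sec_prod.
Qed.

(** The average has norm at most 1 because the constant 1 / #|G| has norm at
    most 1, and the class of an average of translates of f is the average of
    #|G| copies of the class of f. *)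
Lemma average_residue (R : realType) (x : Xval R X) (xG : G_invariant ac x)
    (Gk : #|G|%:R != 0 :> k) (f : sub_ring (val_subring (xnorm x))) :
  (forall g, act_tilde xG g (residue (xnorm x) f) = residue (xnorm x) f) ->
  exists h : val_subring (xnorm x) (average (val f)),
    residue (xnorm x) (mksub h) = residue (xnorm x) f.
Proof.
move=> fG; pose S := sub_ring (val_subring (xnorm x)).
pose fg g : S := mksub (val_map_subproof (xG g) f).
have hc : val_subring (xnorm x) (base_ff X (#|G|%:R^-1)) by exact: msn_le1.
pose m : S := mksub hc * \sum_g fg g.
have me : average (val f) = val m.
  by rewrite rmorphM rmorph_sum.
have h : val_subring (xnorm x) (average (val f)) by rewrite me; exact: subP.
exists h; have -> : mksub h = m by apply: val_inj.
rewrite rmorphM rmorph_sum.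
have -> : \sum_g residue (xnorm x) (fg g) = \sum_(g : G) residue (xnorm x) f.
  apply: eq_bigr => g _; rewrite -[RHS](fG g); apply/esym.
  exact: tilde_map_residue.
have nV : #|G|%:R^-1 *+ #|G| = 1 :> k by rewrite -[LHS]mulr_natr mulVf.
by rewrite sumr_const residue_base mulrnAr -mulrnAl -rmorphMn nV rmorph1 mul1r.
Qed.
End InvariantFractions.

(** * The residue field of the quotient *)

(** The local ring at the kernel of y embeds in K: an invariant section s with
    nonzero norm is invertible in K. The embedding r is determined by the first
    equation, from which the other three follow by clearing denominators. *)
Lemma quotient_function_field (R : realType) (k : fieldType) (X : variety k)
    (G : finGroupType) (ac : gaction G X) (x : Xval R X)
    (U : opens X) (UG : stable ac U) (Une : U !=set0) :
  let y := phi_an UG x Une in let i := inv_to_ff UG Une in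
  exists r : {rmorphism loc (msn_ker y) -> function_field X},
  [/\ forall a s (hs : ~ msn_ker y s), r (Defs.frac a hs) * i s = i a,
    forall l, x (r l) = loc_msn y l,
    forall g l, act_ff ac g (r l) = r l &
    forall a, r (loc_base y a) = base_ff X a].
Proof.
move=> y i.
have i_unit s : ~ msn_ker y s -> is_unit (i s).
  exact: (@function_field_unit _ _ _ x).
have ii g b : act_ff ac g (i b) = i b.
  apply: etrans (act_ff_germ UG Une g (val b)) _.
  by congr (germ _ _); exact: (subP b g).
have [r rE] := loc_lift_exists i_unit; exists r; split=> //.
- move=> l; have [a [s [hs ->]]] := fracP l.
  rewrite [RHS]loc_norm_frac; have /eqP s0 := hs.
  apply: (mulIf s0); rewrite divfK //.
  change (x (r (Defs.frac a hs)) * x (i s) = x (i a)).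
  by rewrite -msnM rE.
- move=> g l; have [a [s [hs ->]]] := fracP l.
  by apply: (is_unit_mulI (i_unit s hs)); rewrite -{1}(ii g s) -rmorphM rE ii.
- move=> a; have := rE (inv_base UG a) 1 (@spec1 _ (msn_ker y)).
  by rewrite (rmorph1 i) mulr1 /i inv_to_ff_base.
Qed.

Theorem theorem5p6 (R : realType) (k : fieldType) (X : variety k)
    (G : finGroupType) (ac : gaction G X)
    (hG : forall q : nat, q \in [pchar k] -> coprime #|G| q)
    (x : Xval R X) (hx : Xstar x) (xG : G_invariant ac x)
    (p : X) (hp : is_center x p)
    (U : opens X) (Uaff : affine_open U) (UG : stable ac U)
    (Up : oset U p) (pfix : forall g : G, ac g p = p) :
  let y := phi_an UG x (ex_intro (oset U) p Up) in
  k_isomorphic (inv_tilde_base xG) (tilde_base (loc_msn y)).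
Proof.
move=> y; set Une := ex_intro (oset U) p Up in y *.
have [r [rE riso ract rbase]] := quotient_function_field x UG Une.
rewrite -/y in r rE riso ract rbase.
pose T := tilde_map riso.
have TG v : inv_subring (act_tilde xG) (T v).
  by move=> g; exact: (tilde_map_fixed riso (xG g) (ract g)).
pose F := @sub_lift _ (inv_subring (act_tilde xG)) _ T TG.
have Finj : injective F.
  by move=> u v /(congr1 val); exact: tilde_map_inj.
have Fsurj u : exists v, F v = u.
  have [f fu] := residue_surj (val u).
  have fG g : act_tilde xG g (residue (xnorm x) f) = residue (xnorm x) f.
    by rewrite fu; exact: (subP u g).
  have [h hf] := average_residue (card_group_neq0 hG) fG.
  have [a [s [su e]]] := average_fraction UG Une Uaff (val f).
  have hs : ~ msn_ker y s.
    by change (~ (x (inv_to_ff UG Une s) = 0)); exact: msn_unit.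
  have rl : r (Defs.frac a hs) = average ac (val f).
    by apply: (is_unit_mulI su); rewrite rE e.
  have hl : val_subring (loc_msn y) (Defs.frac a hs).
    by change (loc_msn y (Defs.frac a hs) <= 1); rewrite -riso rl; exact: h.
  exists (residue (loc_msn y) (mksub hl)); apply: val_inj.
  apply: etrans (tilde_map_residue riso _) _; rewrite -fu -hf.
  by congr (residue _ _); apply: val_inj.
have [psi FK KF] := rmorphism_inverse Finj Fsurj.
exists psi; first by exists F.
move=> a; rewrite -[RHS]FK; congr (psi _); apply: val_inj.
exact: esym (tilde_map_base riso rbase a).
Qed.
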